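(* For every integer $n\ge 4$, $$\Delta_{n,4}\in\mathcal C_{n,12}\quad\Longleftrightarrow\quad 4\le n\le 22.$$ Consequently it is false that for all $n\ge 2$ and all $0\le k\le n-2$ the polynomial $\mathcal D_k^{(n)}$ belongs to the square-graph cone $\mathcal C_{n,(n-k)(n-k-1)}$. More precisely, $\mathcal D_{n-4}^{(n)}\notin\mathcal C_{n,12}$ for every $n\ge 23$, so that $(n,k)=(23,19)$ is the first counterexample inside the family $k=n-4$ (i.e. $\mathcal D_{n-4}^{(n)}\in\mathcal C_{n,12}$ for $4\le n\le 22$ and $\mathcal D_{19}^{(23)}\notin\mathcal C_{23,12}$).
   Context: Let $x_1,\dots,x_n$ be indeterminates, $P(t)=\prod_{i=1}^n(t-x_i)$, and for $0\le k\le n-2$ let $\mathcal D_k^{(n)}=\operatorname{disc}(P^{(k)})\in\mathbb R[x_1,\dots,x_n]$, with the usual leading-coefficient normalization: $\operatorname{disc}(P^{(k)})=(-1)^{m(m-1)/2}c^{-1}\operatorname{Res}(P^{(k)},P^{(k+1)})$, where $m=n-k$ and $c$ is the leading coefficient of $P^{(k)}$. This is a symmetric, translation-invariant, homogeneous polynomial of degree $(n-k)(n-k-1)$. For $n\ge4$ put $\Delta_{n,4}=\left(\frac{24}{n!}\right)^6\mathcal D_{n-4}^{(n)}$; equivalently, $\Delta_{n,4}=\operatorname{disc}(J_{n,4})$, where $J_{n,4}(t)=\frac{4!}{n!}P^{(n-4)}(t)$ is monic of degree 4 (the discriminant is unaffected by translating the roots so that their sum is $0$). For a loopless multigraph $G$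 on the vertex set $\{1,\dots,n\}$ with chosen edge orientations, set $M_G=\prod_{(i,j)\in E(G)}(x_i-x_j)$ (edges counted with multiplicity) and $\widetilde G=\sum_{\sigma\in S_n}M_G(x_{\sigma(1)},\dots,x_{\sigma(n)})$. $G$ is a square graph if every edge has even multiplicity. Its degree is the number of edges counted with multiplicity. The square-graph cone $\mathcal C_{n,d}$ is the set of all finite nonnegative real linear combinations of the polynomials $\widetilde G$, where $G$ runs over square graphs of degree $d$ on $\{1,\dots,n\}$. *)

(* Defs.v *)
From HB Require Import structures.
From mathcomp Require Import all_boot all_order all_algebra all_fingroup.
From mathcomp Require Import mpoly.
From mathcomp Require Import reals.

Set Implicit Arguments.
Unset Strict Implicit.
Unset Printing Implicit Defensive.

Import Order.TTheory GRing.Theory Num.Theory.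
Local Open Scope ring_scope.

(* MathComp's [resultant p q] lists coefficients in ascending order, hence is  *)
(* (-1) ^ (deg p * deg q) times the classical Sylvester determinant.  For      *)
(* q = p^`() with deg q = deg p - 1 this sign is 1.                            *)
Definition disc (A : comUnitRingType) (p : {poly A}) : A :=
  let m := (size p).-1 in
  (-1) ^+ (m * (m - 1))./2 * (lead_coef p)^-1 * resultant p p^`().

Section SquareGraphs.

Variable R : realType.

Definition genericP (n : nat) : {poly {mpoly R[n]}} :=
  \prod_(i < n) ('X - ('X_i)%:P).

Definition Ddisc (n k : nat) : {mpoly R[n]} := disc (genericP n)^`(k).

Definition Delta4 (n : nat) : {mpoly R[n]} :=
  (24%:R / n`!%:R) ^+ 6 *: Ddisc n (n - 4).

(* [mult G i j] is the number of edges joining i and j, so that each edge is   *)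
(* seen twice, from i and from j.                                              *)
Record multigraph (n : nat) := Multigraph {
  mult :> 'I_n -> 'I_n -> nat;
  mult_sym : forall i j, mult i j = mult j i;
  mult_loopless : forall i, mult i i = 0%N
}.

Definition degree (n : nat) (G : multigraph n) : nat :=
  (\sum_(i < n) \sum_(j < n | i < j) G i j)%N.

Definition square_graph (n : nat) (G : multigraph n) : Prop :=
  forall i j, ~~ odd (G i j).

(* Edges are oriented from the smaller to the larger endpoint.  Parallel edges *)
(* must be oriented alike: otherwise -(x_i - x_j)^2 would count as the         *)
(* monomial of a double edge.  With this proviso, reorienting a square graph   *)
(* does not change its monomial.                                               *)
Definition graph_monomial (n : nat) (G : multigraph n) : {mpoly R[n]} :=
  \prod_(i < n) \prod_(j < n | (i < j)%N) ('X_i - 'X_j) ^+ G i j.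

Definition graph_sym (n : nat) (G : multigraph n) : {mpoly R[n]} :=
  \sum_(s : 'S_n) msym s (graph_monomial G).

Definition square_cone (n d : nat) (p : {mpoly R[n]}) : Prop :=
  exists (N : nat) (c : 'I_N -> R) (G : 'I_N -> multigraph n),
    [/\ forall i, 0 <= c i,
        forall i, square_graph (G i) /\ degree (G i) = d
      & p = \sum_(i < N) c i *: graph_sym (G i)].

End SquareGraphs.

(* Main.v *)
(** Write [A l] for the average over all permutations of the variables of the
    monomial with exponents [l].  Multiplying an [A l] by a power sum gives an
    explicit combination of such averages, so the discriminant of
    P^(n-4), which is a polynomial in the power sums p_1, ..., p_4, has a
    computable expansion in the [A l]; so does every square graph, by expanding
    its monomial.  For 4 <= n <= 22 linear programming finds nonnegative
    coefficients expressing the discriminant by sixteen square graphs.  For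
    n >= 23 duality gives one linear form, independent of n in the basis [A l],
    which is nonnegative on all square graphs with six double edges; on the
    discriminant its value is a positive multiple of
    - n (n-1)^2 (n-2)^3 (n-3)^4 q(n), where the polynomial q becomes positive
    between 22 and 23. *)
From Stdlib Require Import ZArith.
Require Import Defs.
From HB Require Import structures.
From mathcomp Require Import all_boot all_order all_algebra all_fingroup.
From mathcomp Require Import mpoly.
From mathcomp Require Import reals.
From mathcomp Require Import zify ssrZ.

Set Implicit Arguments.
Unset Strict Implicit.
Unset Printing Implicit Defensive.

Delimit Scope Z_scope with BZ.

(** * Integer combinations of exponent lists *)

(* [(l, z)] stands for z times the member of index [l] of a family such as
   [avg_mon] or [falling_mon] below: see [ev]. *)
Definition lcomb := seq (seq nat * Z).

Fixpoint add_term (t : seq nat * Z) (P : lcomb) : lcomb :=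
  if P is u :: P' then
    if t.1 == u.1 then (u.1, (t.2 + u.2)%BZ) :: P' else u :: add_term t P'
  else [:: t].

Definition add_lcomb (P Q : lcomb) : lcomb := foldr add_term Q P.

Definition scale_lcomb (c : Z) (P : lcomb) : lcomb := [seq (t.1, (c * t.2)%BZ) | t <- P].

Definition strip (P : lcomb) : lcomb := [seq t <- P | t.2 != 0%BZ].

(** [set_nth] pads with zeros, so [j] may lie beyond the end of [l]. *)
Definition incr_at (k : nat) (l : seq nat) (j : nat) : seq nat := set_nth 0 l j (nth 0 l j + k).

(** The terms of p_k times a falling monomial: the variable taken from the power sum is either new
    to [l] or already has an entry there. Sorting lets like terms merge in [add_term]. *)
Definition raises (k : nat) (l : seq nat) : seq (seq nat) :=
  [seq sort geq l' | l' <- rcons l k :: [seq incr_at k l j | j <- iota 0 (size l)]].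

Definition mul_pow (k : nat) (P : lcomb) : lcomb :=
  foldr (fun t Q => foldr (fun l => add_term (l, t.2)) Q (raises k t.1)) [::] P.

(* Newton's recursion for k! e_k. *)
Definition mul_elem (k : nat) (P : lcomb) : lcomb :=
  let E1 := mul_pow 1 P in
  let E2 := strip (add_lcomb (mul_pow 1 E1) (scale_lcomb (-1) (mul_pow 2 P))) in
  let E3 := strip (add_lcomb (mul_pow 1 E2)
    (add_lcomb (scale_lcomb (-2) (mul_pow 2 E1)) (scale_lcomb 2 (mul_pow 3 P)))) in
  let E4 := strip (add_lcomb (mul_pow 1 E3) (add_lcomb (scale_lcomb (-3) (mul_pow 2 E2))
    (add_lcomb (scale_lcomb 6 (mul_pow 3 E1)) (scale_lcomb (-6) (mul_pow 4 P))))) in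
  nth [::] [:: P; E1; E2; E3; E4] k.

(* [(z, (i0, i1, i2, i3, i4))] stands for z a^i0 b^i1 c^i2 d^i3 e^i4 in the
   discriminant of a t^4 + b t^3 + c t^2 + d t + e. *)
Definition disc_term := (Z * (nat * nat * nat * nat * nat))%type.

Definition disc_terms : seq disc_term :=
  [:: (256%BZ, (3, 0, 0, 0, 3)); ((-192)%BZ, (2, 1, 0, 1, 2));
      ((-128)%BZ, (2, 0, 2, 0, 2)); (144%BZ, (2, 0, 1, 2, 1));
      ((-27)%BZ, (2, 0, 0, 4, 0)); (144%BZ, (1, 2, 1, 0, 2));
      ((-6)%BZ, (1, 2, 0, 2, 1)); ((-80)%BZ, (1, 1, 2, 1, 1));
      (18%BZ, (1, 1, 1, 3, 0)); (16%BZ, (1, 0, 4, 0, 1));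
      ((-4)%BZ, (1, 0, 3, 2, 0)); ((-27)%BZ, (0, 4, 0, 0, 2));
      (18%BZ, (0, 3, 1, 1, 1)); ((-4)%BZ, (0, 3, 0, 3, 0));
      ((-4)%BZ, (0, 2, 3, 0, 1)); (1%BZ, (0, 2, 2, 2, 0))].

(* The leading coefficient and the normalisations of the others are scalars:
   see [disc_coef]. *)
Definition elem_monomial (t : disc_term) : lcomb :=
  let: (_, (_, i1, i2, i3, i4)) := t in
  iter i1 (mul_elem 1) (iter i2 (mul_elem 2)
    (iter i3 (mul_elem 3) (iter i4 (mul_elem 4) [:: ([::], 1%BZ)]))).

(** * Graphs as edge lists *)

(* Each listed edge is a double edge of the square graph. *)
Definition edges := seq (nat * nat).

Definition times_edge (ab : nat * nat) (P : lcomb) : lcomb :=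
  flatten [seq [:: (incr_at 2 t.1 ab.1, t.2);
                   (incr_at 1 (incr_at 1 t.1 ab.1) ab.2, (-2 * t.2)%BZ);
                   (incr_at 2 t.1 ab.2, t.2)] | t <- P].

Definition expand (g : edges) : lcomb := foldr times_edge [:: ([::], 1%BZ)] g.

(** The partition on which alone the average of a monomial depends: see [avg_mon_exponents]. *)
Definition exponents (l : seq nat) : seq nat := sort geq [seq x <- l | x != 0].

(* 33 times a dual solution of the linear program which decides membership for
   n = 23. *)
Definition weights : lcomb :=
  [:: ([:: 12], (-33)%BZ); ([:: 6; 6], 264%BZ); ([:: 7; 5], (-33)%BZ);
      ([:: 8; 4], 9%BZ); ([:: 9; 3], (-33)%BZ); ([:: 10; 2], (-207)%BZ);
      ([:: 4; 4; 4], 264%BZ); ([:: 5; 4; 3], 132%BZ); ([:: 7; 3; 2], (-33)%BZ);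
      ([:: 8; 2; 2], 85%BZ); ([:: 3; 3; 3; 3], 33%BZ)].

Fixpoint lookup (P : lcomb) (l : seq nat) : Z :=
  if P is t :: P' then
    if t.1 == l then (t.2 + lookup P' l)%BZ else lookup P' l
  else 0%BZ.

Definition weight (l : seq nat) : Z := lookup weights (exponents l).

(** For n >= 12, n! times this integer is the value of the dual form on the symmetrised graph: see
    [weight_form_edge_sym]. *)
Definition edges_weight (g : edges) : Z :=
  foldr (fun t => Z.add (t.2 * weight t.1)) 0%BZ (expand g).

Definition swap_label (p q a : nat) := if a == p then q else if a == q then p else a.

Definition orient (ab : nat * nat) := if ab.1 <= ab.2 then ab else (ab.2, ab.1).

Definition lexi (x y : nat * nat) := (x.1 < y.1) || ((x.1 == y.1) && (x.2 <= y.2)).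

Definition swap_edges p q (g : edges) : edges :=
  [seq (swap_label p q ab.1, swap_label p q ab.2) | ab <- g].

(** One more than the largest label, so that the labels from [order g] on are free. *)
Definition order (g : edges) : nat :=
  foldr maxn 0 [seq (maxn ab.1 ab.2).+1 | ab <- g].

Definition neighbours (g : edges) (a : nat) : seq nat :=
  flatten [seq if ab.1 == a then [:: ab.2] else if ab.2 == a then [:: ab.1] else [::] | ab <- g].

Definition sumN (s : seq N) : N := foldr N.add 0%num s.

Definition keys (g : edges) : seq N :=
  let d := [seq N.of_nat (size (neighbours g a)) | a <- iota 0 (order g)] in
  [seq (3 * nth 0 d a + sumN [seq nth 0 d b * nth 0 d b | b <- neighbours g a])%num
     | a <- iota 0 (order g)].

(* Any sequence of label swaps is sound here; this one puts the vertices of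
   large key first, with a bonus for the neighbours of those already placed,
   which nearly identifies isomorphic graphs: the levels below contain 1, 3, 8,
   23, 68, 223 lists for the 1, 3, 8, 23, 66, 212 multigraphs with 1 to 6
   edges. *)
Fixpoint settle (m i : nat) (k : seq N) (g : edges) : edges :=
  if m is m'.+1 then
    let s := drop i k in
    let j := index (foldr N.max 0%num s) s + i in
    let g' := if (i < 12) && (j < 12) then swap_edges i j g else g in
    let k' := set_nth 0%num k j (nth 0%num k i) in
    let nb := neighbours g' i in
    settle m' i.+1
      [seq (nth 0 k' a + N.of_nat (count_mem a nb * 10 * (14 - i)))%num
         | a <- iota 0 (size k)] g'
  else g.

Definition normalize (g : edges) : edges :=
  sort lexi [seq orient ab | ab <- settle (order g) 0 (keys g) g].

(* Every edge not of this form becomes so after swapping labels that do not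
   occur in [g]. *)
Definition extensions (g : edges) : seq edges :=
  let v := order g in
  [seq ab :: g | ab <- (v, v.+1) :: [seq (a, b) | b <- iota 1 v, a <- iota 0 b]].

Definition next_level (L : seq edges) : seq edges :=
  undup [seq normalize g | g <- flatten [seq extensions g | g <- L]].

(* [order g <= 10] leaves room for two new labels below 12. *)
Fixpoint check_levels (m : nat) (L : seq edges) : bool :=
  if m is m'.+1 then all (fun g => order g <= 10) L && check_levels m' (next_level L)
  else all (fun g => (order g <= 12) && (0 <=? edges_weight g)%BZ) L.

(** * Certificates for n <= 22 *)

(** The first graph is K_4, whose doubled edges give the discriminant itself when n = 4. *)
Definition cert_graphs : seq edges := [::
  [:: (0, 1); (0, 2); (0, 3); (1, 2); (1, 3); (2, 3)];
  [:: (0, 1); (0, 2); (1, 2); (3, 4); (3, 4); (3, 4)];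
  [:: (0, 1); (1, 2); (2, 3); (2, 4); (3, 4); (3, 4)];
  [:: (0, 1); (0, 2); (1, 2); (3, 4); (4, 5); (4, 5)];
  [:: (0, 1); (1, 2); (1, 3); (2, 3); (2, 3); (4, 5)];
  [:: (0, 1); (2, 3); (2, 3); (4, 5); (4, 5); (4, 5)];
  [:: (0, 3); (1, 4); (2, 5); (3, 4); (3, 5); (4, 5)];
  [:: (0, 1); (0, 2); (1, 2); (3, 4); (5, 6); (5, 6)];
  [:: (0, 1); (0, 2); (1, 2); (3, 6); (4, 6); (5, 6)];
  [:: (0, 1); (0, 2); (1, 2); (1, 2); (3, 4); (5, 6)];
  [:: (0, 3); (1, 4); (2, 5); (3, 6); (4, 6); (5, 6)];
  [:: (0, 1); (2, 3); (4, 5); (6, 7); (6, 7); (6, 7)];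
  [:: (0, 1); (2, 3); (4, 5); (4, 5); (6, 7); (6, 7)];
  [:: (0, 1); (0, 2); (1, 2); (3, 4); (5, 6); (7, 8)];
  [:: (0, 1); (2, 3); (4, 5); (6, 7); (8, 9); (8, 9)];
  [:: (0, 1); (2, 3); (4, 5); (6, 7); (8, 9); (10, 11)]].

(* [(n, k, g, cs)] certifies that k 24^6 disc(P^(n-4)) / (n-4)!^6 is g / n! times
   the combination of the symmetrised [cert_graphs] with coefficients [cs].
   Graphs with more than n vertices have coefficient 0. *)
Definition cert_rows : seq (nat * Z * Z * seq Z) := [::
  ((4, 1%BZ, 191102976%BZ),
    [:: 1; 0; 0; 0; 0; 0; 0; 0; 0; 0; 0; 0; 0; 0; 0; 0]%BZ);
  ((5, 1%BZ, 3822059520%BZ),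
    [:: 47; 2; 48; 0; 0; 0; 0; 0; 0; 0; 0; 0; 0; 0; 0; 0]%BZ);
  ((6, 1%BZ, 64497254400%BZ),
    [:: 233; 35; 390; 18; 63; 27; 0; 0; 0; 0; 0; 0; 0; 0; 0; 0]%BZ);
  ((7, 1%BZ, 1070176665600%BZ),
    [:: 395; 104; 870; 0; 195; 135; 0; 26; 32; 150; 0; 0; 0; 0; 0; 0]%BZ);
  ((8, 1%BZ, 1170505728000%BZ),
    [:: 5375; 1781; 14250; 0; 3375; 3375; 0; 1059; 438; 5850; 0; 450; 495; 0; 0; 0]%BZ);
  ((9, 1%BZ, 42475311857664%BZ),
    [:: 1444; 538; 4380; 0; 990; 1350; 0; 642; 84; 2940; 0; 420; 555; 60; 0; 0]%BZ);
  ((10, 1%BZ, 41295442083840%BZ),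
    [:: 10682; 4178; 35868; 0; 7350; 13230; 0; 8614; 268; 33600; 0; 6720; 10020; 2120; 915; 0]%BZ);
  ((11, 19%BZ, 1089745610342400%BZ),
    [:: 43886; 17192; 159348; 0; 29106; 66906; 0; 55692; 0; 191016; 1008; 47880; 77805;
        23940; 17955; 0]%BZ);
  ((12, 19%BZ, 1580343975936000%BZ),
    [:: 143708; 54448; 554448; 0; 91728; 256704; 0; 261408; 0; 806568; 14784; 239400;
        414960; 164920; 165585; 1995]%BZ);
  ((13, 19%BZ, 4133318492160000%BZ),
    [:: 225646; 79716; 914976; 0; 132336; 457488; 0; 549792; 0; 1563192; 33696; 526680;
        959994; 462840; 562590; 17955]%BZ);
  ((14, 19%BZ, 1654980724260864%BZ),
    [:: 2053346; 651560; 8678460; 0; 1052190; 4615110; 0; 6375780; 0; 16993260; 322920;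
        6320160; 11993940; 6751080; 9426375; 538650]%BZ);
  ((15, 19%BZ, 22218633369354240%BZ),
    [:: 504052; 137632; 2206248; 0; 211860; 1233540; 0; 1920600; 0; 4858920; 63360; 1956240;
        3837240; 2457840; 3818430; 329175]%BZ);
  ((16, 1%BZ, 11700784934092800%BZ),
    [:: 132492; 37860; 681402; 0; 0; 397485; 75724; 688028; 0; 1665444; 32472; 720720;
        1453320; 1040160; 1760220; 207900]%BZ);
  ((17, 1%BZ, 6240200137113600%BZ),
    [:: 801640; 133978; 3707340; 0; 171990; 2235870; 0; 4244682; 12324; 9909900; 0; 4504500;
        9298575; 7335900; 13320450; 2027025]%BZ);
  ((18, 1%BZ, 8947059130368000%BZ),
    [:: 1465250; 159866; 6919500; 0; 204750; 4299750; 0; 8910174; 86268; 20092800; 0;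
        9609600; 20240220; 17417400; 33558525; 6306300]%BZ);
  ((19, 1%BZ, 328806411276386304%BZ),
    [:: 98624; 4724; 474240; 0; 6720; 302400; 0; 678916; 11032; 1485120; 0; 742560; 1591590;
        1481480; 3003000; 675675]%BZ);
  ((20, 1%BZ, 1166797165015203840%BZ),
    [:: 60114; 0; 311256; 0; 0; 204180; 15600; 501904; 19648; 1055400; 31200; 556920;
        1212120; 1212120; 2567565; 675675]%BZ);
  ((21, 1%BZ, 1003332962864332800%BZ),
    [:: 100678; 0; 734298; 0; 0; 506685; 205836; 1440172; 160480; 2802756; 441048; 1627920;
        3591420; 3836560; 8446620; 2552550]%BZ);
  ((22, 1%BZ, 419489061691392000%BZ),
    [:: 220948; 0; 3363822; 0; 0; 2461671; 1936356; 8096856; 1406424; 14660676; 4167288;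
        9302400; 20771280; 23590560; 53742780; 18378360]%BZ)].

Definition ffactZ (x : Z) (m : nat) : Z :=
  foldr (fun i z => ((x - Z.of_nat i) * z)%BZ) 1%BZ (iota 0 m).

Definition powZ (z : Z) (m : nat) : Z := iter m (Z.mul z) 1%BZ.

(* Up to the factor (n-4)!, the quartic 24 P^(n-4) has coefficients
   (-1)^k C(4, k) (n-k) ... (n-3) k! e_k; here [x] is n. *)
Definition disc_coef (x : Z) (t : disc_term) : Z :=
  let: (c, (i0, i1, i2, i3, _)) := t in
  (c * (powZ (x * (x - 1) * (x - 2) * (x - 3)) i0 *
   (powZ ((-4) * ((x - 1) * (x - 2) * (x - 3))) i1 *
   (powZ (6 * ((x - 2) * (x - 3))) i2 * powZ ((-4) * (x - 3)) i3))))%BZ.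

Definition weigh (x : Z) (P : lcomb) : lcomb :=
  [seq (t.1, (ffactZ x (size t.1) * t.2)%BZ) | t <- P].

Definition sum_lcomb (cs : seq Z) (Ps : seq lcomb) : lcomb :=
  foldr add_lcomb [::] [seq scale_lcomb cP.1 cP.2 | cP <- zip cs Ps].

Definition collect (P : lcomb) : lcomb :=
  foldr add_term [::] [seq (exponents t.1, t.2) | t <- P].

Definition edge_in (m : nat) (ab : nat * nat) := (ab.1 < m) && (ab.2 < m).

Definition proper_edge (m : nat) (ab : nat * nat) := edge_in m ab && (ab.1 != ab.2).

Definition check_row (DP GP : seq lcomb) (row : nat * Z * Z * seq Z) : bool :=
  let: (n, k, g, cs) := row in
  let x := Z.of_nat n in
  [&& (0 <? k)%BZ, (0 <=? g)%BZ,
      all (fun cg => (cg.1 == 0%BZ) ||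
        [&& (0 <=? cg.1)%BZ, all (proper_edge n) cg.2 & size cg.2 == 6]) (zip cs cert_graphs) &
      strip (add_lcomb
        (weigh x (scale_lcomb k (sum_lcomb [seq disc_coef x t | t <- disc_terms] DP)))
        (scale_lcomb (Z.opp g) (sum_lcomb cs GP))) == [::]].

Definition check_rows : bool :=
  all (check_row [seq elem_monomial t | t <- disc_terms]
                 [seq collect (expand g) | g <- cert_graphs]) cert_rows.

(** * The sign of the dual linear form on the discriminant *)

(** Terms are separated by length because a falling monomial of length m carries the factor n (n-1)
    ... (n-m+1), the only dependence on n in its pairing. *)
Definition pairing (m : nat) (P : lcomb) : Z :=
  foldr (fun t z => if size t.1 == m then (t.2 * weight t.1 + z)%BZ else z) 0%BZ P.

Definition term_pairings : seq (disc_term * Z * Z) :=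
  [seq (t, pairing 3 (elem_monomial t), pairing 4 (elem_monomial t)) | t <- disc_terms].

Definition disc_pairing (x : Z) (s : seq (disc_term * Z * Z)) : Z :=
  foldr (fun u z => (disc_coef x u.1.1 * (ffactZ x 3 * u.1.2 + ffactZ x 4 * u.2) + z)%BZ)
    0%BZ s.

Lemma term_pairingsE : term_pairings =
  zip (zip disc_terms
    [:: 0; 0; 0; 0; 57024; 0; 0; 0; 114048; 0; 190080; 0; 0; 142560; 0; 247104]%BZ)
    [:: 19008; 19008; 19008; 28512; 42768; 19008; 33264; 38016;
        64152; 47520; 80784; 19008; 42768; 76032; 53856; 95040]%BZ.
Proof. by vm_compute. Qed.

Lemma disc_pairing_lt0 x : (23 <= x)%BZ -> (disc_pairing x term_pairings < 0)%BZ.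
Proof.
move=> x23; rewrite term_pairingsE.
(* After the shift by 23 the factor of degree six has only positive coefficients, which shows its
   sign. *)
have [y [y0 ->]] : exists y, (0 <= y)%BZ /\ x = (y + 23)%BZ by exists (x - 23)%BZ; lia.
set s := zip _ _.
have -> : disc_pairing (y + 23) s =
  (- (3649536 * ((y + 23) * (y + 22)^2 * (y + 21)^3 * (y + 20)^4 *
    (y^6 + 102 * y^5 + 4171 * y^4 + 85572 * y^3 + 884074 * y^2 + 3748560 * y
     + 957456))))%BZ.
  rewrite /s; cbn -[Z.mul Z.add Z.sub]; ring.
apply/Z.opp_neg_pos/Z.mul_pos_pos; first by [].
by do ! apply: Z.mul_pos_pos; lia.
Qed.

From mathcomp Require Import ring.
Import Order.TTheory GRing.Theory Num.Theory.
Local Open Scope ring_scope.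

(** * Averaged monomials *)

(* k! e_k in terms of the power sums [p], for k <= 4. *)
Definition newton (A : comNzRingType) (p : nat -> A) (k : nat) : A :=
  nth 0 [:: 1; p 1%N; p 1%N ^+ 2 - p 2%N;
    p 1%N ^+ 3 - 3%:R * p 1%N * p 2%N + 2%:R * p 3%N;
    p 1%N ^+ 4 - 6%:R * p 1%N ^+ 2 * p 2%N + 3%:R * p 2%N ^+ 2
      + 8%:R * p 1%N * p 3%N - 6%:R * p 4%N] k.

Section Eval.
Variable F : numFieldType.
Definition ZtoF (z : Z) : F := (int_of_Z z)%:~R.

Lemma ZtoF0 : ZtoF 0%BZ = 0. Proof. by []. Qed.

Lemma ZtoF1 : ZtoF 1%BZ = 1. Proof. by []. Qed.

Lemma ZtoFD x y : ZtoF (x + y)%BZ = ZtoF x + ZtoF y.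
Proof. by rewrite -intrD -(rmorphD int_of_Z). Qed.

Lemma ZtoFM x y : ZtoF (x * y)%BZ = ZtoF x * ZtoF y.
Proof. by rewrite -intrM -(rmorphM int_of_Z). Qed.

Lemma ZtoFN x : ZtoF (- x)%BZ = - ZtoF x.
Proof. by rewrite -mulrNz -(rmorphN int_of_Z). Qed.

Lemma ZtoF_nat m : ZtoF (Z.of_nat m) = m%:R.
Proof. by rewrite /ZtoF (_ : int_of_Z _ = m) //; case: m => //= m; lia. Qed.

Lemma ZtoF_ge0 z : (0 <= z)%BZ -> 0 <= ZtoF z.
Proof. by case: z => [|p|p] // _; rewrite ler0z. Qed.

Lemma ZtoF_gt0 z : (0 < z)%BZ -> 0 < ZtoF z.
Proof. by case: z => // p _; rewrite ltr0z /=; lia. Qed.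

(** * Evaluation of integer combinations *)

Section Comb.
Variables (V : lmodType F) (B : seq nat -> V).
Definition ev (P : lcomb) : V := \sum_(t <- P) ZtoF t.2 *: B t.1.

Lemma ev_add_term t P : ev (add_term t P) = ZtoF t.2 *: B t.1 + ev P.
Proof.
elim: P => [|u P IH] /=; first by rewrite /ev big_seq1 big_nil addr0.
case: eqP => [->|_]; rewrite /ev !big_cons /=.
  by rewrite ZtoFD scalerDl addrA.
by rewrite -/(ev _) IH addrCA.
Qed.

Lemma ev_add P Q : ev (add_lcomb P Q) = ev P + ev Q.
Proof.
elim: P => [|t P IH] /=; first by rewrite {2}/ev big_nil add0r.
by rewrite ev_add_term IH {3}/ev big_cons addrA.
Qed.

Lemma ev_scale c P : ev (scale_lcomb c P) = ZtoF c *: ev P.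
Proof.
by rewrite /ev big_map scaler_sumr; apply: eq_bigr => t _; rewrite ZtoFM scalerA.
Qed.

Lemma ev_strip P : ev (strip P) = ev P.
Proof.
rewrite /ev big_filter [RHS](bigID (fun t => t.2 == 0%BZ)) /= [X in X + _]big1 ?add0r //.
by move=> t /eqP ->; rewrite ZtoF0 scale0r.
Qed.
End Comb.

(** * Products of power sums and averaged monomials *)

Section Average.
Variable n : nat.
Notation poly := {mpoly F[n]}.
Definition perm_mon (s : 'S_n) (l : seq nat) : poly := \prod_(i < n) 'X_(s i) ^+ nth 0 l i.

Definition avg_mon (l : seq nat) : poly := n`!%:R^-1 *: \sum_(s : 'S_n) perm_mon s l.

Lemma filter_pad (l : seq nat) :
  perm_eq l ([seq x <- l | x != 0%N] ++ nseq (size l - size [seq x <- l | x != 0%N]) 0%N).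
Proof.
rewrite -(perm_filterC (predC1 0%N)) perm_cat2l.
have -> : size l = (count (predC1 0%N) l + count (predC (predC1 0%N)) l)%N by rewrite count_predC.
rewrite -size_filter addKn -size_filter.
rewrite (_ : nseq _ _ = [seq x <- l | predC (predC1 0%N) x]) //.
apply/esym/all_pred1P/allP => x; rewrite mem_filter /= negbK; case/andP => //.
Qed.

(** Padded with zeros to length n, the two lists are permutations of each other, and the permutation
    is absorbed by reindexing the average. *)
Lemma avg_mon_perm l l' : (size l <= n)%N -> (size l' <= n)%N ->
  perm_eq [seq x <- l | x != 0%N] [seq x <- l' | x != 0%N] -> avg_mon l = avg_mon l'.
Proof.
move=> sl sl' ll'.
pose pad (k : seq nat) := k ++ nseq (n - size k) 0%N.
have size_pad k : (size k <= n)%N -> size (pad k) = n.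
  by move=> sk; rewrite size_cat size_nseq subnKC.
have filter_padE k : [seq x <- pad k | x != 0%N] = [seq x <- k | x != 0%N].
  by rewrite filter_cat [X in _ ++ X](_ : _ = [::]) ?cats0 //; elim: (n - _)%N.
have nth_pad k i : nth 0%N (pad k) i = nth 0%N k i.
  by rewrite nth_cat; case: ltnP => // ki; rewrite nth_nseq if_same nth_default.
have : perm_eq (pad l) (pad l').
  rewrite (permPl (filter_pad _)) perm_sym (permPl (filter_pad _)) perm_sym.
  by rewrite !filter_padE !size_pad // (perm_size ll') perm_cat2r.
have sz' : size (pad l') == n by rewrite size_pad.
rewrite -[pad l']/(tval (Tuple sz')) => /tuple_permP[t lt].
rewrite /avg_mon; congr (_ *: _).
rewrite (reindex_inj (mulgI t)); apply: eq_bigr => s _.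
rewrite /perm_mon [RHS](reindex_inj (@perm_inj _ t)); apply: eq_bigr => i _.
rewrite permM -(nth_pad l) -(nth_pad l') lt; congr ('X_(_) ^+ _).
by rewrite (nth_map i) ?size_enum_ord // nth_ord_enum (tnth_nth 0%N).
Qed.

Lemma avg_mon_exponents l : (size l <= n)%N -> avg_mon (exponents l) = avg_mon l.
Proof.
move=> sl; have sl' : (size (exponents l) <= n)%N.
  by rewrite size_sort (leq_trans _ sl) // size_filter count_size.
apply: avg_mon_perm => //; rewrite -[X in perm_eq _ X]filter_id.
by apply: perm_filter; rewrite /exponents perm_sort.
Qed.

Definition power_sum k : poly := \sum_(i < n) 'X_i ^+ k.

Lemma size_incr_at k l j : size (incr_at k l j) = maxn j.+1 (size l).
Proof. by rewrite size_set_nth. Qed.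

Lemma perm_mon_incr_at s k l (j : 'I_n) :
  perm_mon s (incr_at k l j) = 'X_(s j) ^+ k * perm_mon s l.
Proof.
rewrite /perm_mon (bigD1 j) //= [in RHS](bigD1 j) //= nth_set_nth /= eqxx.
rewrite addnC exprD -!mulrA; congr (_ * (_ * _)).
by apply: eq_bigr => i ij; rewrite nth_set_nth /= (negPf (ij : (val i != val j))).
Qed.

(** Multiplying by the variable at position j raises the j-th exponent by k; the n - [size l]
    positions past the end of [l] all give the same average. *)
Lemma power_sum_avg_mon k l : (size l <= n)%N ->
  power_sum k * avg_mon l =
  (n - size l)%:R *: avg_mon (rcons l k) + \sum_(0 <= j < size l) avg_mon (incr_at k l j).
Proof.
move=> sl.
have -> : power_sum k * avg_mon l = \sum_(0 <= j < n) avg_mon (incr_at k l j).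
  rewrite big_mkord -scaler_sumr exchange_big /= -scalerAr; congr (_ *: _).
  rewrite mulr_sumr; apply: eq_bigr => s _.
  rewrite /power_sum (reindex_inj (@perm_inj _ s)) mulr_suml.
  by apply: eq_bigr => j _; rewrite perm_mon_incr_at.
rewrite (@big_cat_nat _ _ _ (size l)) //= addrC; congr (_ + _).
rewrite scaler_nat -sumr_const_nat; apply: eq_big_nat => i /andP[li ni].
apply: avg_mon_perm; first by rewrite size_incr_at geq_max sl ni.
  by rewrite size_rcons (leq_ltn_trans li).
rewrite /incr_at nth_default // add0n set_nthE ltnNge li /= -cats1 !filter_cat.
by rewrite perm_cat2l; elim: (i - _)%N.
Qed.

(* The sum over all injective assignments of variables to the entries of [l];
   in this normalisation the product rule does not involve n, and the terms
   with [size l > n] vanish. *)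
Definition falling_mon l : poly := (n ^_ (size l))%:R *: avg_mon l.

Lemma falling_mon_perm l l' : perm_eq l l' -> falling_mon l = falling_mon l'.
Proof.
move=> ll'; rewrite /falling_mon -(perm_size ll').
have [sl|sl] := leqP (size l) n; last by rewrite ffact_small // !scale0r.
by congr (_ *: _); apply: avg_mon_perm; rewrite -?(perm_size ll') // perm_filter.
Qed.

Lemma power_sum_falling_mon k l :
  power_sum k * falling_mon l =
  falling_mon (rcons l k) + \sum_(0 <= j < size l) falling_mon (incr_at k l j).
Proof.
rewrite /falling_mon -scalerAr size_rcons.
have szb j : (j < size l)%N -> size (incr_at k l j) = size l.
  by move=> jl; rewrite size_incr_at; apply/maxn_idPr.
have [sl|sl] := leqP (size l) n; last first.
  rewrite !ffact_small ?ltnS ?(ltnW sl) // !scale0r add0r big_nat big1 // => j /= jl.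
  by rewrite szb // ffact_small ?scale0r.
rewrite power_sum_avg_mon // scalerDr scalerA -natrM -ffactnSr; congr (_ + _).
by rewrite scaler_sumr; apply: eq_big_nat => j /= jl; rewrite szb.
Qed.

Lemma ev_mul_pow k P : ev falling_mon (mul_pow k P) = power_sum k * ev falling_mon P.
Proof.
elim: P => [|t P IH]; first by rewrite /ev !big_nil mulr0.
rewrite /= [in RHS]/ev big_cons mulrDr -/(ev _ _) -IH.
rewrite -scalerAr power_sum_falling_mon.
rewrite -(falling_mon_perm (l := sort geq (rcons t.1 k))) ?perm_sort //.
rewrite ev_add_term /= scalerDr -addrA; congr (_ + _).
rewrite -map_comp /index_iota subn0.
elim: (iota _ _) => [|j s IHs] /=; first by rewrite big_nil scaler0 add0r.
rewrite ev_add_term IHs big_cons scalerDr addrA; congr (_ *: _ + _ + _).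
by apply: falling_mon_perm; rewrite perm_sort.
Qed.

Definition elem (k : nat) : poly := newton power_sum k.

Lemma ev_mul_elem k P : ev falling_mon (mul_elem k P) = elem k * ev falling_mon P.
Proof.
have ZE c (q : poly) : ZtoF c *: q = (int_of_Z c)%:~R * q by rewrite scaler_int mulrzl.
rewrite /mul_elem /elem /newton.
by case: k => [|[|[|[|[|k]]]]] /=;
  rewrite ?nth_nil ?ev_strip ?ev_add ?ev_scale ?ev_mul_pow ?ev_strip ?ev_add ?ev_scale ?ev_mul_pow
   ?ev_strip ?ev_add ?ev_scale ?ev_mul_pow ?ZE; first [ring|rewrite /ev big_nil mul0r].
Qed.
End Average.
End Eval.

(** * The discriminant of a quartic *)

Section Det.
Variable A : comNzRingType.
Definition drop_row (i : nat) (M : seq (seq (option A))) := take i M ++ drop i.+1 M.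

(* [None] is a zero entry, for which no minor is developed. *)
Definition laplace_term (minor : seq (seq (option A)) -> A) M (i : nat) (x : A) : A :=
  if head None (nth [::] M i) is Some y then
    let z := y * minor (map behead (drop_row i M)) in (if odd i then - z else z) + x
  else x.

Fixpoint laplace (m : nat) (M : seq (seq (option A))) : A :=
  if m is m'.+1 then foldr (laplace_term (laplace m') M) 0 (iota 0 m'.+1) else 1.

Lemma laplaceS m M : laplace m.+1 M = foldr (laplace_term (laplace m) M) 0 (iota 0 m.+1).
Proof. by []. Qed.

(** Expansion along the first column; skipping the [None] entries keeps the expansion of the sparse
    Sylvester matrix small. *)
Lemma det_laplace m (M : seq (seq (option A))) : size M = m ->
  \det (\matrix_(i < m, j < m) odflt 0 (nth None (nth [::] M i) j)) = laplace m M.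
Proof.
elim: m M => [|m IH] M sM; first by rewrite det_mx00.
rewrite (expand_det_col _ ord0) -big_enum laplaceS -val_enum_ord.
have {IH} : forall M, size M = m -> laplace m M = _ := fun M sM => esym (IH M sM).
move: (laplace m) => minor IH.
elim: (enum 'I_m.+1) => [|i s IHs]; first by rewrite big_nil.
rewrite big_cons /= IHs mxE /laplace_term nth0.
case: (head None _) => [y|] /=; last by rewrite mul0r add0r.
rewrite /cofactor addn0 -signr_odd.
have -> : minor [seq behead i0 | i0 <- drop_row i M] = \det (row' i (col' ord0
    (\matrix_(i < m.+1, j < m.+1) odflt 0 (nth None (nth [::] M i) j)))).
  rewrite IH.
    congr (\det _); apply/esym/matrixP => k l; rewrite !mxE /=.
    have sd : size (drop_row i M) = m.
      by rewrite size_cat size_take size_drop sM ltn_ord subnKC // -ltnS.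
    rewrite (nth_map [::]) ?sd // nth_behead /bump /= add1n; congr (odflt 0 (nth None _ _)).
    rewrite nth_cat size_take sM ltn_ord; case: ltnP => ki.
      by rewrite nth_take // leqNgt ki.
    by rewrite nth_drop; congr (nth _ _ _); rewrite addSn subnKC ?ki.
  rewrite size_map size_cat size_take size_drop sM ltn_ord subnKC // -ltnS //.
by case: (odd i); rewrite ?expr1 ?expr0 ?mul1r ?mulN1r ?mulrN.
Qed.
End Det.

Definition quartic_disc (A : comNzRingType) (a b c d e : A) : A :=
  256%:R * a ^+ 3 * e ^+ 3 - 192%:R * a ^+ 2 * b * d * e ^+ 2
  - 128%:R * a ^+ 2 * c ^+ 2 * e ^+ 2 + 144%:R * a ^+ 2 * c * d ^+ 2 * e
  - 27%:R * a ^+ 2 * d ^+ 4 + 144%:R * a * b ^+ 2 * c * e ^+ 2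
  - 6%:R * a * b ^+ 2 * d ^+ 2 * e - 80%:R * a * b * c ^+ 2 * d * e
  + 18%:R * a * b * c * d ^+ 3 + 16%:R * a * c ^+ 4 * e
  - 4%:R * a * c ^+ 3 * d ^+ 2 - 27%:R * b ^+ 4 * e ^+ 2
  + 18%:R * b ^+ 3 * c * d * e - 4%:R * b ^+ 3 * d ^+ 3
  - 4%:R * b ^+ 2 * c ^+ 3 * e + b ^+ 2 * c ^+ 2 * d ^+ 2.

(** [a *+ 4 != 0] keeps the derivative of degree 3, so the Sylvester matrix has size 7; its
    determinant has the factor [a], which is a unit and cancels. The sign is (-1)^6. *)
Lemma disc_quarticE (A : comUnitRingType) (a b c d e : A) :
  a \is a GRing.unit -> a *+ 4 != 0 ->
  disc (Poly [:: e; d; c; b; a]) = quartic_disc a b c d e.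
Proof.
move=> ua a4.
have a0 : a != 0 by apply: contraNneq a4 => ->; rewrite mul0rn.
pose p := @Polynomial A [:: e; d; c; b; a] a0.
pose q := @Polynomial A [:: d; c *+ 2; b *+ 3; a *+ 4] a4.
have -> : Poly [:: e; d; c; b; a] = p by apply: val_inj; apply: (@PolyK _ 0).
have pq : p^`() = q.
  by apply/polyP => i; rewrite coef_deriv; case: i => [|[|[|[|i]]]] //=; rewrite !nth_nil mul0rn.
have rpq : resultant p q = a * quartic_disc a b c d e.
  pose S := Some : A -> option A.
  rewrite /resultant.
  have -> : Sylvester_mx p q = \matrix_(i < 7, j < 7) odflt 0 (nth None (nth [::]
     [:: [:: S e; S d; S c; S b; S a];
         [:: None; S e; S d; S c; S b; S a];
         [:: None; None; S e; S d; S c; S b; S a];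
         [:: S d; S (c *+ 2); S (b *+ 3); S (a *+ 4)];
         [:: None; S d; S (c *+ 2); S (b *+ 3); S (a *+ 4)];
         [:: None; None; S d; S (c *+ 2); S (b *+ 3); S (a *+ 4)];
         [:: None; None; None; S d; S (c *+ 2); S (b *+ 3); S (a *+ 4)]] i) j).
    apply/matrixP => i j; rewrite Sylvester_mxE mxE.
    case: splitP => -[k lt_k] /= ->; case: j => j lt_j /=.
      by case: k lt_k => [|[|[|]]] // _; case: j lt_j => [|[|[|[|[|[|[|]]]]]]].
    by case: k lt_k => [|[|[|[|]]]] // _; case: j lt_j => [|[|[|[|[|[|[|]]]]]]].
  rewrite det_laplace // /S {S}.
  rewrite (_ : ((size q).-1 + (size p).-1)%N = 7%N) //.
  (* Only the list bookkeeping is reduced; the ring operations stay folded for [ring]. *)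
  lazy beta iota zeta delta
    [laplace laplace_term foldr iota head nth drop_row take drop cat map behead odd negb].
  rewrite /quartic_disc; ring.
rewrite /disc pq rpq /lead_coef /= -signr_odd mul1r mulKr //.
Qed.

(** * Derivatives of the generic polynomial *)

Section Newton.
Variable A : comNzRingType.

(** Adding a root [c] sends the coefficient e_k to e_k + c e_(k-1), so all k <= 4 are treated in one
    induction on [s]. Below, [g s (4 - k)] is (-1)^k e_k, and [g s 5 = 0] feeds the recursion at
    index 4. *)
Lemma coef_prod_XsubC (s : seq A) (k : nat) : (k <= 4)%N -> (k <= size s)%N ->
  k`!%:R * (\prod_(c <- s) ('X - c%:P))`_(size s - k) =
  (-1) ^+ k * newton (fun j => \sum_(c <- s) c ^+ j) k.
Proof.
pose p s j : A := \sum_(c <- s) c ^+ j.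
(* The factor 'X^4 keeps the indices from truncating when s is short. *)
pose g (s : seq A) j : A := ('X^4 * \prod_(c <- s) ('X - c%:P))`_(size s + j).
have H : [/\ g s 5 = 0, g s 4 = 1, g s 3 = - p s 1%N, 2%:R * g s 2 = newton (p s) 2
    & 6%:R * g s 1 = - newton (p s) 3 /\ 24%:R * g s 0 = newton (p s) 4].
  rewrite /newton /=; elim: s => [|c s [g5 g4 g3 g2 [g1 g0]]].
    rewrite /g /p !big_nil !mulr1 !coefXn /=; do !split; ring.
  have pE j : p (c :: s) j = c ^+ j + p s j by rewrite /p big_cons.
  have gE j : g (c :: s) j = g s j - c * g s j.+1.
    rewrite /g big_cons mulrCA mulrBl coefB coefXM coefCM /= addSn /=; congr (_ - c * _).
    by rewrite addnS.
  rewrite !pE !gE g5.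
  have -> : g s 6 = 0.
    rewrite /g nth_default // (leq_trans (size_polyMleq _ _)) //.
    by rewrite size_polyXn size_prod_XsubC; lia.
  split.
  - ring.
  - by rewrite g4; ring.
  - by rewrite g4 g3; ring.
  - by rewrite mulrBr g2 g3; ring.
  split.
    have -> : 6%:R * (g s 1 - c * g s 2) = 6%:R * g s 1 - 3%:R * c * (2%:R * g s 2) by ring.
    by rewrite g1 g2; ring.
  have -> : 24%:R * (g s 0 - c * g s 1) = 24%:R * g s 0 - 4%:R * c * (6%:R * g s 1) by ring.
  by rewrite g0 g1; ring.
move=> k4 ks; have -> : (\prod_(c <- s) ('X - c%:P))`_(size s - k) = g s (4 - k)%N.
  rewrite /g coefXnM ifN; last by rewrite -leqNgt; lia.
  by congr (_`_ _); lia.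
case: H => _ g4 g3 g2 [g1 g0]; rewrite /newton in g0 g1 g2 *.
case: k k4 {ks} => [|[|[|[|[|//]]]]] _ /=.
- by rewrite [g s _]g4 fact0 !mul1r.
- by rewrite [g s _]g3 (_ : 1`! = 1%N) // /p; ring.
- by rewrite (_ : 2`! = 2%N) // [_ * g s _]g2 /= /p; ring.
- by rewrite (_ : 3`! = 6%N) // [_ * g s _]g1 /= /p; ring.
by rewrite (_ : 4`! = 24%N) // [_ * g s _]g0 /= /p; ring.
Qed.
End Newton.

(** * The discriminant of P^(n-4) in terms of power sums *)

Section DerivDisc.
Variable R : realType.

Lemma genericP_coef n k : (k <= 4)%N -> (k <= n)%N ->
  k`!%:R * (genericP R n)`_(n - k) = (-1) ^+ k * elem R n k.
Proof.
move=> k4 kn; pose s : seq {mpoly R[n]} := [seq 'X_i | i <- enum 'I_n].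
have sz : size s = n by rewrite size_map size_enum_ord.
have -> : genericP R n = \prod_(c <- s) ('X - c%:P) by rewrite big_map big_enum.
have := @coef_prod_XsubC _ s k; rewrite sz => -> //; congr (_ * _).
suff E j : \sum_(c <- s) c ^+ j = power_sum R n j by rewrite /elem /newton /= !E.
by rewrite big_map big_enum.
Qed.

Definition quartic_scalar (n k : nat) : R := (-1) ^+ k * ('C(4, k) * (n - k) ^_ (4 - k))%:R.

Lemma derivn_genericP_coef n k : (4 <= n)%N -> (k <= 4)%N ->
  24%:R * (genericP R n)^`(n - 4)`_(4 - k) = (n - 4)`!%:R * (quartic_scalar n k *: elem R n k).
Proof.
move=> n4 k4; rewrite coef_derivn (_ : (n - 4 + (4 - k) = n - k)%N); last by lia.
have E := genericP_coef k4 (leq_trans k4 n4).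
(* Multiplied by (4-k)!, both sides become 24 (n-k)!. *)
have N : (24 * (n - k) ^_ (n - 4) = (n - 4)`! * ('C(4, k) * (n - k) ^_ (4 - k)) * k`!)%N.
  have h1 : ((n - k) ^_ (n - 4) * (4 - k)`! = (n - k)`!)%N.
    by rewrite -(@ffact_fact (n - k) (n - 4)); [congr (_ * _`!)%N; lia | lia].
  have h2 : ((n - k) ^_ (4 - k) * (n - 4)`! = (n - k)`!)%N.
    by rewrite -(@ffact_fact (n - k) (4 - k)); [congr (_ * _`!)%N; lia | lia].
  have h3 := bin_fact k4.
  apply/eqP; rewrite -(eqn_pmul2r (fact_gt0 (4 - k))); apply/eqP.
  rewrite -mulnA h1 -h2 -[24%N]/(4`!) -h3; ring.
rewrite -[_ *+ (_ ^_ _)]mulr_natl mulrA -natrM N natrM -mulrA E.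
rewrite -mul_mpolyC /quartic_scalar !rmorphM /= !rmorph_nat rmorph_sign.
ring.
Qed.

Lemma quartic_discZ (A : comNzRingType) (u a b c d e : A) :
  quartic_disc (u * a) (u * b) (u * c) (u * d) (u * e) = u ^+ 6 * quartic_disc a b c d e.
Proof. by rewrite /quartic_disc; ring. Qed.

(** The quartic discriminant is homogeneous of degree 6, which accounts for the sixth powers of 24
    and (n-4)!. The leading coefficient is a nonzero constant, hence a unit, so [disc_quarticE]
    applies. *)
Lemma Ddisc_elem n : (4 <= n)%N ->
  (24%:R : R) ^+ 6 *: Ddisc R n (n - 4) = (n - 4)`!%:R ^+ 6 *:
    quartic_disc (quartic_scalar n 0 *: elem R n 0) (quartic_scalar n 1 *: elem R n 1)
      (quartic_scalar n 2 *: elem R n 2) (quartic_scalar n 3 *: elem R n 3)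
      (quartic_scalar n 4 *: elem R n 4).
Proof.
move=> n4; pose q := (genericP R n)^`(n - 4).
have sP : size (genericP R n) = n.+1.
  by rewrite /genericP -big_enum size_prod_XsubC -cardE card_ord.
have qE : q = Poly [:: q`_0; q`_1; q`_2; q`_3; q`_4].
  apply/polyP => i; rewrite coef_Poly; case: i => [|[|[|[|[|i]]]]] //=.
  by rewrite nth_nil coef_derivn nth_default ?mul0rn // sP; lia.
have c4 := derivn_genericP_coef n4 (isT : (0 <= 4)%N).
have c3 := derivn_genericP_coef n4 (isT : (1 <= 4)%N).
have c2 := derivn_genericP_coef n4 (isT : (2 <= 4)%N).
have c1 := derivn_genericP_coef n4 (isT : (3 <= 4)%N).
have c0 := derivn_genericP_coef n4 (isT : (4 <= 4)%N).
pose x : R := 24%:R^-1 * (n - 4)`!%:R * quartic_scalar n 0.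
have x0 : x != 0.
  rewrite !mulf_neq0 ?invr_eq0 ?pnatr_eq0 -?lt0n ?fact_gt0 //.
    by rewrite expr0 oner_eq0.
  by rewrite bin0 mul1n ffact_gt0 !subn0.
have q4x : q`_4 = x%:MP.
  apply: (@mulfI _ 24%:R); first by rewrite -mpolyC_nat mpolyC_eq0 pnatr_eq0.
  rewrite [LHS]c4 /elem /newton /= -!mul_mpolyC mulr1 -!mpolyC_nat -!mpolyCM; congr _%:MP.
  by rewrite /x !mulrA mulfV ?pnatr_eq0 // mul1r.
have D : Ddisc R n (n - 4) = quartic_disc q`_4 q`_3 q`_2 q`_1 q`_0.
  rewrite -disc_quarticE -?qE // q4x.
    by apply: rmorph_unit; rewrite unitfE.
  by rewrite -mpolyCMn mpolyC_eq0 mulrn_eq0.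
rewrite -mul_mpolyC rmorphXn /= mpolyC_nat.
rewrite -[RHS]mul_mpolyC rmorphXn /= mpolyC_nat D -!quartic_discZ.
by rewrite -c4 -c3 -c2 -c1 -c0.
Qed.
End DerivDisc.

(** * Square graphs *)

Section EdgeMon.
Variables (F : numFieldType) (n : nat).
Notation poly := {mpoly F[n]}.
(** A label that is not below n has the value 0. *)
Definition label_var (s : 'S_n) (a : nat) : poly := if insub a is Some i then 'X_(s i) else 0.

Definition edge_mon (s : 'S_n) (g : edges) : poly :=
  \prod_(ab <- g) (label_var s ab.1 - label_var s ab.2) ^+ 2.

Definition edge_sym (g : edges) : poly := \sum_(s : 'S_n) edge_mon s g.

Lemma label_var_ord s (i : 'I_n) : label_var s i = 'X_(s i).
Proof. by rewrite /label_var valK. Qed.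

Lemma ev_times_edge s ab P : edge_in n ab ->
  ev (@perm_mon F n s) (times_edge ab P) =
  (label_var s ab.1 - label_var s ab.2) ^+ 2 * ev (@perm_mon F n s) P.
Proof.
case: ab => a b /andP[/= an bn].
rewrite -[a]/(val (Ordinal an)) -[b]/(val (Ordinal bn)) !label_var_ord.
move: (Ordinal an) (Ordinal bn) => i j {a b an bn}.
rewrite /ev /times_edge big_flatten big_map mulr_sumr; apply: eq_bigr => t _.
rewrite !big_cons big_nil !perm_mon_incr_at ZtoFM -!mul_mpolyC !rmorphM /=.
rewrite [ZtoF F (-2)](_ : _ = - 2%:R) //.
by rewrite rmorphN rmorph_nat; ring.
Qed.

Lemma ev_expand s g : all (edge_in n) g -> ev (@perm_mon F n s) (expand g) = edge_mon s g.
Proof.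
elim: g => [_|ab g IH /= /andP[abn gn]].
  rewrite /ev /edge_mon big_seq1 big_nil ZtoF1 scale1r /perm_mon big1 // => i _.
  by rewrite nth_nil.
by rewrite ev_times_edge // IH // /edge_mon big_cons.
Qed.

Lemma size_expand g : all (edge_in n) g -> all (fun t => size t.1 <= n)%N (expand g).
Proof.
elim: g => //= ab g IH /andP[/andP[an bn] /IH{IH}/allP IH].
apply/allP => t /flattenP[r /mapP[u /IH un ->]].
by rewrite !inE => /or3P[] /eqP -> /=; rewrite !size_incr_at !geq_max ?an ?bn.
Qed.

Lemma ev_avg_mon P : ev (@avg_mon F n) P = n`!%:R^-1 *: \sum_(s : 'S_n) ev (@perm_mon F n s) P.
Proof.
rewrite exchange_big scaler_sumr; apply: eq_bigr => t _.
by rewrite /avg_mon -scaler_sumr !scalerA mulrC.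
Qed.

Lemma edge_symE g : all (edge_in n) g -> edge_sym g = n`!%:R *: ev (@avg_mon F n) (expand g).
Proof.
move=> gn; rewrite ev_avg_mon scalerA mulfV ?scale1r; last first.
  by rewrite pnatr_eq0 -lt0n fact_gt0.
by apply: eq_bigr => s _; rewrite ev_expand.
Qed.

Lemma ev_collect P : all (fun t => size t.1 <= n)%N P ->
  ev (@avg_mon F n) (collect P) = ev (@avg_mon F n) P.
Proof.
rewrite /collect; elim: P => //= t P IH /andP[tn Pn].
by rewrite ev_add_term IH // /ev big_cons avg_mon_exponents.
Qed.

Lemma edge_sym_perm g g' : perm_eq g g' -> edge_sym g = edge_sym g'.
Proof. by move=> gg; apply: eq_bigr => s _; apply: perm_big. Qed.

Lemma edge_sym_orient g : edge_sym [seq orient ab | ab <- g] = edge_sym g.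
Proof.
apply: eq_bigr => s _; rewrite /edge_mon big_map; apply: eq_bigr => -[a b] _.
by rewrite /orient /=; case: ifP => // _; rewrite -sqrrN opprB.
Qed.

(** The transposition of [p] and [q] is absorbed by reindexing the sum over the symmetric group;
    labels from n on are fixed. *)
Lemma edge_sym_swap p q g : (p < n)%N -> (q < n)%N -> edge_sym (swap_edges p q g) = edge_sym g.
Proof.
move=> pn qn; pose t := tperm (Ordinal pn) (Ordinal qn).
rewrite /edge_sym (reindex_inj (mulgI t)); apply: eq_bigr => s _.
rewrite /edge_mon big_map; apply: eq_bigr => ab _ /=.
suff E a : label_var (t * s) (swap_label p q a) = label_var s a by rewrite !E.
have [an|an] := ltnP a n; last first.
  have nap : a != p by apply: contraTneq an => ->; rewrite -ltnNge.
  have naq : a != q by apply: contraTneq an => ->; rewrite -ltnNge.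
  rewrite /swap_label (negPf nap) (negPf naq) /label_var insubF //.
  by rewrite ltnNge an.
have -> : swap_label p q a = val (t (Ordinal an)).
  by rewrite permE /= /swap_label -!(inj_eq val_inj) /= (fun_if val) (fun_if val).
by rewrite label_var_ord permM tpermK -[a]/(val (Ordinal an)) label_var_ord.
Qed.

End EdgeMon.

(** * Enumeration of six-edge multigraphs *)

Section Enum.
Variables (F : numFieldType) (n : nat).
Hypothesis n12 : (12 <= n)%N.
Notation sym := (@edge_sym F n).

Lemma proper_swap p q e : (p < n)%N -> (q < n)%N ->
  all (proper_edge n) e -> all (proper_edge n) (swap_edges p q e).
Proof.
move=> pn qn; rewrite all_map; apply: sub_all => -[a b] /andP[/andP[/= an bn] ab].
have swapK : involutive (swap_label p q).
  move=> c; rewrite /swap_label; case: (eqVneq c p) => [->|cp].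
    by rewrite eqxx; case: eqP.
  case: (c =P q) => [cq|/eqP/negPf cq]; first by rewrite eqxx.
  by rewrite (negPf cp) cq.
have lt_swap c : (c < n)%N -> (swap_label p q c < n)%N.
  by rewrite /swap_label; case: ifP => // _; case: ifP.
by rewrite /proper_edge /edge_in /= !lt_swap // (can_eq swapK).
Qed.

Lemma proper_in e : all (proper_edge n) e -> all (edge_in n) e.
Proof. by apply: sub_all => ab /andP[]. Qed.

Lemma swap_edges_cat p q g h : swap_edges p q (g ++ h) = swap_edges p q g ++ swap_edges p q h.
Proof. exact: map_cat. Qed.

(* The edges [e] still to be added are relabelled along with [g]. *)
Lemma settle_sym m i k g e : all (proper_edge n) e ->
  exists2 e', all (proper_edge n) e' /\ size e' = size e &
    sym (e ++ g) = sym (e' ++ settle m i k g).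
Proof.
elim: m i k g e => [|m IH] i k g e en /=; first by exists e.
set j := (_ + i)%N; set k' := [seq _ | _ <- _].
(* The guard in [settle] keeps both labels below 12 <= n, so the swap permutes the variables. *)
case: ifP => [/andP[i12 j12]|_]; last exact: IH.
have [lin ljn] : (i < n)%N /\ (j < n)%N by split; apply: leq_trans n12.
have [e' [e'n se'] E] := IH i.+1 k' (swap_edges i j g) _ (proper_swap lin ljn en).
exists e'; first by rewrite se' size_map.
by rewrite -E -swap_edges_cat edge_sym_swap.
Qed.

Lemma normalize_sym g e : all (proper_edge n) e ->
  exists2 e', all (proper_edge n) e' /\ size e' = size e &
    sym (e ++ g) = sym (e' ++ normalize g).
Proof.
move=> en; have [e' He' E] := settle_sym (order g) 0 (keys g) g en.
exists e' => //; rewrite {}E /normalize -edge_sym_orient map_cat.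
rewrite -[RHS]edge_sym_orient map_cat; apply: edge_sym_perm.
rewrite perm_cat2l.
have orientK : [seq orient ab | ab <- [seq orient ab | ab <- settle (order g) 0 (keys g) g]] =
   [seq orient ab | ab <- settle (order g) 0 (keys g) g].
  rewrite -map_comp; apply: eq_map => -[a b]; rewrite /orient /=.
  by case: (leqP a b) => ab /=; rewrite ?ab // ltnW.
by rewrite -{1}orientK; apply: perm_map; rewrite perm_sym perm_sort.
Qed.

Lemma swap_edges_order p q g : (order g <= p)%N -> (order g <= q)%N -> swap_edges p q g = g.
Proof.
elim: g => //= -[a b] g IH; rewrite /order /= !geq_max ?gtn_max -!andbA.
move=> /and3P[ap bp gp] /and3P[aq bq gq].
by rewrite IH // /swap_label !ltn_eqF.
Qed.

(** An endpoint not below [v] can be moved to [v] or [v.+1] by a swap that fixes [g], the remaining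
    edges [e] being relabelled with it. The cases are: both endpoints below [v], only the smaller
    one, neither. *)
Lemma extension_sym g e ab : (order g <= 10)%N -> all (proper_edge n) (ab :: e) ->
  exists e' g', [/\ all (proper_edge n) e', size e' = size e, g' \in extensions g &
    sym (e ++ ab :: g) = sym (e' ++ g')].
Proof.
move=> g10; set v := order g.
have lvn : (v < n)%N by lia.
have lvn1 : (v.+1 < n)%N by lia.
(* Edges are doubled, so reversing one leaves the monomial unchanged. *)
wlog lt_ab : ab / (ab.1 < ab.2)%N => [hw|].
  case: ab => a b /andP[/[dup] abn /andP[/andP[/= an bn] ab]] en.
  case: (ltngtP a b) ab => // lt_ab _; first by apply: (hw (a, b)) => //=; apply/andP.
  have [//|/=|e' [g' [*]]] := hw (b, a).
    by apply/andP; split=> //; rewrite /proper_edge /edge_in /= an bn neq_ltn lt_ab.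
  exists e', g'; split=> //; rewrite -edge_sym_orient.
  rewrite (_ : [seq _ | _ <- _] = [seq orient x | x <- e ++ (b, a) :: g]) ?edge_sym_orient //.
  rewrite !map_cat /=; congr (_ ++ _ :: _).
  by rewrite /orient /= leqNgt lt_ab /= ltnW.
case: ab lt_ab => a b /= lt_ab /andP[/andP[/andP[/= an bn] ab] en].
have in_ext c d : (c < d)%N -> (d <= v)%N -> (c, d) :: g \in extensions g.
  move=> cd dv; apply/map_f; rewrite inE; apply/orP; right; apply/allpairsPdep.
  by exists d, c; rewrite !mem_iota; split => //; lia.
have [bv|vb] := ltnP b v.
  by exists e, ((a, b) :: g); split=> //; apply: in_ext => //; apply: ltnW.
have [av|va] := ltnP a v.
  exists (swap_edges v b e), ((a, v) :: g); split.
  - exact: proper_swap.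
  - by rewrite size_map.
  - exact: in_ext.
  rewrite -(edge_sym_swap F (e ++ _) lvn bn) swap_edges_cat /= (@swap_edges_order v b g) //.
  have -> : swap_label v b a = a by rewrite /swap_label !ltn_eqF.
  by have -> : swap_label v b b = v by rewrite /swap_label eqxx; case: eqP.
exists (swap_edges v.+1 b (swap_edges v a e)), ((v, v.+1) :: g); split.
- by do 2 apply: proper_swap => //.
- by rewrite !size_map.
- by apply: map_f; rewrite inE eqxx.
rewrite -(edge_sym_swap F (e ++ _) lvn an) swap_edges_cat /= (@swap_edges_order v a g) //.
have -> : swap_label v a a = v by rewrite /swap_label eqxx; case: eqP.
have -> : swap_label v a b = b by rewrite /swap_label !gtn_eqF //; lia.
rewrite -(edge_sym_swap F (_ ++ _) lvn1 bn) swap_edges_cat /= (@swap_edges_order v.+1 b g) //.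
have -> : swap_label v.+1 b b = v.+1 by rewrite /swap_label eqxx; case: eqP.
by have -> : swap_label v.+1 b v = v by rewrite /swap_label !ltn_eqF //; lia.
Qed.

(** Induction on the number of edges of [e] still to be added: one of them joins [g], the result is
    normalised into the next level, and the others follow the relabelling. *)
Lemma check_levels_sym (Q : {mpoly F[n]} -> Prop) :
  (forall g, all (edge_in n) g -> (0 <= edges_weight g)%BZ -> Q (sym g)) ->
  forall m L g e, check_levels m L -> g \in L -> all (proper_edge n) e -> size e = m ->
  Q (sym (e ++ g)).
Proof.
move=> Qval; elim=> [|m IH] L g e /=.
  move=> /allP HL gL _ /size0nil ->; have /andP[g12 /Z.leb_le vg] := HL g gL.
  apply: Qval => //; move: g12; rewrite /order.
  elim: (g) => //= -[a b] s IHs; rewrite !geq_max ?gtn_max -!andbA => /and3P[a12 b12 s12].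
  by rewrite IHs // /edge_in /= !(leq_trans _ n12).
move=> /andP[/allP HL HL'] gL; case: e => [//|ab e] abe [se].
have [e' [g' [e'n se' g'g E]]] := extension_sym (HL g gL) abe.
have [e'' [e''n se''] E'] := normalize_sym g' e'n.
have -> : sym ((ab :: e) ++ g) = sym (e ++ ab :: g).
  by apply: edge_sym_perm; rewrite -[_ ++ g]/([:: ab] ++ e ++ g) perm_catCA.
rewrite E E'; apply: (IH (next_level L)) => //; last by rewrite se'' se'.
by rewrite mem_undup; apply/map_f/flattenP; exists (extensions g) => //; apply/map_f.
Qed.
End Enum.

(** * Multigraphs and edge lists *)

Section Bridge.
Variables (R : realType) (n : nat).

Lemma msym_var (s : 'S_n) i : msym s ('X_i : {mpoly R[n]}) = 'X_(s i).
Proof.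
rewrite msymX; congr 'X_[_]; apply/mnmP => j; rewrite !mnmE.
by rewrite -(inj_eq (@perm_inj _ s)) permKV.
Qed.

Lemma graph_sym_edge_mon (G : multigraph n) g : all (edge_in n) g ->
  graph_monomial R G = edge_mon R 1 g -> graph_sym R G = edge_sym R n g.
Proof.
move=> gn E; apply: eq_bigr => s _; rewrite E /edge_mon rmorph_prod /=.
apply: eq_big_seq => -[a b] /(allP gn)/andP[/= an bn].
rewrite rmorphXn rmorphB /=; congr ((_ - _) ^+ 2).
  by rewrite -[a]/(val (Ordinal an)) !label_var_ord msym_var perm1.
by rewrite -[b]/(val (Ordinal bn)) !label_var_ord msym_var perm1.
Qed.

(** Each pair i < j is listed half as often as its multiplicity, which is even. *)
Lemma square_graph_edges (G : multigraph n) : square_graph G ->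
  exists g, [/\ all (proper_edge n) g, degree G = (2 * size g)%N & graph_sym R G = edge_sym R n g].
Proof.
move=> sqG.
pose ps := [seq ij : 'I_n * 'I_n <- index_enum _ | (ij.1 < ij.2)%N].
pose g : edges := flatten [seq nseq (G ij.1 ij.2)./2 (val ij.1, val ij.2) | ij <- ps].
have G2 i j : (2 * (G i j)./2 = G i j)%N.
  by rewrite mul2n -[RHS]odd_double_half (negPf (sqG i j)).
have gP : all (proper_edge n) g.
  apply/allP => ab /flattenP[r /mapP[[i j]]]; rewrite mem_filter /= => /andP[ij _] ->.
  by rewrite mem_nseq => /andP[_ /eqP ->]; rewrite /proper_edge /edge_in /= !ltn_ord neq_ltn ij.
exists g; split => //.
  rewrite /degree pair_big_dep /= -(big_filter _ (fun ij : 'I_n * 'I_n => ij.1 < ij.2)%N).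
  rewrite size_flatten sumnE !big_map big_distrr /=.
  by apply: eq_bigr => -[i j] _; rewrite size_nseq G2.
apply: graph_sym_edge_mon; first exact: proper_in gP.
rewrite /graph_monomial pair_big_dep /= -(big_filter _ (fun ij : 'I_n * 'I_n => ij.1 < ij.2)%N).
rewrite /edge_mon big_flatten big_map; apply: eq_bigr => -[i j] _ /=.
by rewrite big_nseq iter_mulr_1 !label_var_ord !perm1 -exprM G2.
Qed.

(** The test [i != j] makes [edge_mult] loopless for every edge list. *)
Definition edge_ind (ab : nat * nat) (i j : 'I_n) : bool :=
  (i != j) && ((ab == (val i, val j)) || (ab == (val j, val i))).

Definition edge_mult (g : edges) (i j : 'I_n) : nat :=
  (2 * count (fun ab => edge_ind ab i j) g)%N.

Lemma edge_mult_sym g i j : edge_mult g i j = edge_mult g j i.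
Proof. by congr (2 * _)%N; apply: eq_count => ab; rewrite /edge_ind eq_sym orbC. Qed.

Lemma edge_mult_loopless g i : edge_mult g i i = 0%N.
Proof. by rewrite /edge_mult /edge_ind eqxx /= count_pred0. Qed.

Definition edge_graph g := Multigraph (edge_mult_sym g) (edge_mult_loopless g).

Lemma big_edge (T : Type) (idx : T) (op : Monoid.com_law idx) (f : 'I_n -> 'I_n -> T) (a b : 'I_n) :
  (a < b)%N -> (forall i j : 'I_n, (i < j)%N -> (i, j) != (a, b) -> f i j = idx) ->
  \big[op/idx]_(i < n) \big[op/idx]_(j < n | (i < j)%N) f i j = f a b.
Proof.
move=> ab fidx; rewrite pair_big_dep /= (bigD1 (a, b)) //= big1 ?Monoid.mulm1 //.
by case=> i j /= /andP[ij]; apply: fidx.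
Qed.

Lemma edge_graph_square g : square_graph (edge_graph g).
Proof. by move=> i j; rewrite /= /edge_mult mul2n odd_double. Qed.

Lemma edge_mult_cons ab g i j : edge_mult (ab :: g) i j = (2 * edge_ind ab i j + edge_mult g i j)%N.
Proof. by rewrite /edge_mult /= mulnDr. Qed.

(** Stated for any commutative monoid in order to serve twice: addition yields the degree,
    multiplication the graph monomial. *)
Lemma big_edge_graph (T : Type) (idx : T) (op : Monoid.com_law idx) (f : nat -> nat -> nat -> T) g :
  (forall i j m m', f i j (m + m')%N = op (f i j m) (f i j m')) -> (forall i j, f i j 0%N = idx) ->
  (forall i j, f i j 2 = f j i 2) -> all (proper_edge n) g ->
  \big[op/idx]_(i < n) \big[op/idx]_(j < n | (i < j)%N) f i j (edge_graph g i j) =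
  \big[op/idx]_(ab <- g) f ab.1 ab.2 2.
Proof.
move=> fD f0 fC; elim: g => [_|ab g IH /= /andP[abn gn]].
  by rewrite big_nil big1 // => i _; rewrite big1 // => j _; rewrite f0.
rewrite big_cons -IH //.
under eq_bigr => i _ do under eq_bigr => j _ do rewrite /= edge_mult_cons fD.
under eq_bigr => i _ do rewrite big_split /=.
rewrite big_split /=; congr (op _ _).
wlog lt_ab : ab abn {gn} / (ab.1 < ab.2)%N => [hw|].
  case: ab abn => a b /= abn; case: (ltngtP a b) (abn) => [lt_ab _|lt_ab _|-> ].
  - exact: (hw (a, b)).
  - rewrite fC -(hw (b, a)) //=.
      apply: eq_bigr => i _; apply: eq_bigr => j _; congr (f i j (2 * nat_of_bool (_ && _))%N).
      by rewrite /= !xpair_eqE orbC; congr (_ || _); rewrite andbC.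
    by move: abn; rewrite /proper_edge /edge_in /= eq_sym andbC [(b < n)%N && _]andbC andbC.
  by rewrite /proper_edge eqxx andbF.
case: ab abn lt_ab => a b /andP[/andP[/= an bn] ab] lt_ab.
rewrite -[a]/(val (Ordinal an)) -[b]/(val (Ordinal bn)) in lt_ab *.
move: (Ordinal an) (Ordinal bn) lt_ab => {ab a b an bn} i j ij.
rewrite (big_edge op ij) => [|k l kl nkl].
  by rewrite /edge_ind !eqxx neq_ltn ij.
rewrite /edge_ind !xpair_eqE.
rewrite xpair_eqE in nkl.
rewrite ![val _ == val k]eq_sym ![val _ == val l]eq_sym (negPf nkl) /=.
case: (val l =P val i) => [li|_]; last by rewrite !andbF; apply: f0.
case: (val k =P val j) => [kj|_]; last by rewrite !andbF; apply: f0.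
by move: kl ij; rewrite li kj => /ltn_trans h /h; rewrite ltnn.
Qed.

Lemma degree_edge_graph g : all (proper_edge n) g -> degree (edge_graph g) = (2 * size g)%N.
Proof.
move=> gn; rewrite /degree (@big_edge_graph _ _ _ (fun _ _ m => m)) //.
by rewrite big_const_seq count_predT iter_addn_0.
Qed.

Lemma graph_sym_edge_graph g : all (proper_edge n) g -> graph_sym R (edge_graph g) = edge_sym R n g.
Proof.
move=> gn; apply: graph_sym_edge_mon; first exact: proper_in gn.
pose x a := label_var R (1 : 'S_n) a.
rewrite /edge_mon -[RHS](@big_edge_graph _ _ _ (fun a b m => (x a - x b) ^+ m)) //.
- by apply: eq_bigr => i _; apply: eq_bigr => j _; rewrite /x !label_var_ord !perm1.
- by move=> i j m m'; rewrite exprD.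
by move=> i j; rewrite -sqrrN opprB.
Qed.
End Bridge.

(** * The dual linear form *)

Section Functional.
Variables (F : numFieldType) (n : nat).
Notation poly := {mpoly F[n]}.
Definition mnm_of (l : seq nat) : 'X_{1..n} := [multinom nth 0%N l i | i < n].

(** The coefficient is the proportion of permutations that carry one exponent vector to the
    other. *)
Lemma mcoeff_avg_mon l l' :
  (avg_mon F n l)@_(mnm_of l') =
  n`!%:R^-1 * (\sum_(s : 'S_n) [forall i : 'I_n, nth 0 l i == nth 0 l' (s i)] : nat)%:R.
Proof.
rewrite mcoeffZ raddf_sum natr_sum /=; congr (_ * _); apply: eq_bigr => s _.
have -> : perm_mon F s l = 'X_[[multinom nth 0%N l ((s^-1)%g i) | i < n]].
  by rewrite (mpolyXE _ s); apply: eq_bigr => i _; rewrite mnmE permK.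
rewrite mcoeffX; congr (nat_of_bool _)%:R.
apply/eqP/forallP => [/mnmP E i|E].
  by have := E (s i); rewrite !mnmE permK => ->.
by apply/mnmP => i; rewrite !mnmE (eqP (E _)) permKV.
Qed.

Lemma mcoeff_avg_mon_neq0 l : (avg_mon F n l)@_(mnm_of l) != 0.
Proof.
rewrite mcoeff_avg_mon mulf_neq0 ?invr_eq0 ?pnatr_eq0 -?lt0n ?fact_gt0 //.
rewrite (bigD1 1%g) //= (_ : [forall _, _] = true) //.
by apply/forallP => i; rewrite perm1.
Qed.

Lemma mcoeff_avg_mon_eq0 l l' : (size l <= n)%N -> (size l' <= n)%N ->
  exponents l != exponents l' -> (avg_mon F n l)@_(mnm_of l') = 0.
Proof.
move=> sl sl' ll'; rewrite mcoeff_avg_mon big1 ?mulr0 // => s _.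
apply/eqP; rewrite eqb0; apply: contraNN ll' => /forallP E; apply/eqP.
have padE (k : seq nat) : (size k <= n)%N ->
  [seq x <- [seq nth 0%N k i | i : 'I_n] | x != 0%N] = [seq x <- k | x != 0%N].
  move=> sk; rewrite /image_mem (map_comp (nth 0%N k) val) val_enum_ord.
  rewrite -(subnKC sk) iotaD map_cat filter_cat.
  rewrite -[X in map _ (iota 0 X)]/(size k) map_nth_iota0 ?take_size //.
  rewrite [X in _ ++ X](_ : _ = [::]) ?cats0 //.
  apply/eqP; rewrite -[_ == _]negbK -has_filter; apply/negP => /hasP[x /mapP[i]].
  by rewrite mem_iota => /andP[ki _] ->; rewrite nth_default.
rewrite /exponents; apply/perm_sortP; first by move=> x y; apply: leq_total.
- by move=> x y z yx zy; apply: leq_trans zy yx.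
- by move=> x y; rewrite andbC => /anti_leq.
rewrite -(padE l) // -(padE l') //; apply: perm_filter.
rewrite /image_mem (@eq_map _ _ _ (fun i => nth 0%N l' (s i))); last first.
  by move=> i; rewrite (eqP (E i)).
rewrite (map_comp (fun i : 'I_n => nth 0%N l' i)); apply: perm_map.
rewrite uniq_perm ?(map_inj_uniq (@perm_inj _ s)) ?enum_uniq // => i.
rewrite mem_enum inE; apply/mapP; exists (s^-1 i)%g; by rewrite ?mem_enum ?permKV.
Qed.

(** Dividing by the coefficient of a monomial in its own average makes the value on that average
    equal to the listed weight, whatever n >= 4 is. *)
Definition weight_form (f : poly) : F :=
  \sum_(t <- weights) ZtoF F t.2 * ((avg_mon F n t.1)@_(mnm_of t.1))^-1 * f@_(mnm_of t.1).

Fact weight_form_linear : scalar weight_form.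
Proof.
move=> a f g; rewrite /weight_form mulr_sumr -big_split; apply: eq_bigr => t _ /=.
by rewrite mcoeffD mcoeffZ mulrDr mulrCA.
Qed.

HB.instance Definition _ := GRing.isLinear.Build F poly F _ weight_form weight_form_linear.

Lemma weight_form_avg_mon l : (4 <= n)%N -> (size l <= n)%N ->
  weight_form (avg_mon F n l) = ZtoF F (weight l).
Proof.
move=> n4 ln; rewrite /weight_form /weight.
(* The listed partitions have at most four parts, so [mnm_of] truncates none of them. *)
have: all (fun t => (size t.1 <= 4)%N && (exponents t.1 == t.1)) weights by [].
elim: weights => [|t w IH] /=; first by rewrite big_nil.
move=> /andP[/andP[t4 /eqP tE] wP]; rewrite big_cons {}IH //.
have tn := leq_trans t4 n4.
case: eqP => [tl|/eqP tl]; last first.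
  rewrite (@mcoeff_avg_mon_eq0 l t.1) ?mulr0 ?add0r //.
  by rewrite tE eq_sym.
rewrite ZtoFD -mulrA (@avg_mon_perm _ _ l t.1) ?mulVf ?mulr1 ?mcoeff_avg_mon_neq0 //.
apply: (perm_trans (y := t.1)); first by rewrite tl perm_sym perm_sort.
by rewrite -{1}tE perm_sort.
Qed.
End Functional.

(** * Non-membership for n >= 23 and membership for n <= 22 *)

Lemma quartic_disc_terms (A : comNzRingType) (a b c d e : A) :
  quartic_disc a b c d e = \sum_(t <- disc_terms)
    let: (z, (i0, i1, i2, i3, i4)) := t in
    (int_of_Z z)%:~R * (a ^+ i0 * (b ^+ i1 * (c ^+ i2 * (d ^+ i3 * e ^+ i4)))).
Proof.
have pos p : (int_of_Z (Zpos p))%:~R = (Pos.to_nat p)%:R :> A by [].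
have neg p : (int_of_Z (Zneg p))%:~R = - (Pos.to_nat p)%:R :> A.
  by rewrite -[Zneg p]/(- Zpos p) (rmorphN int_of_Z) mulrNz pos.
rewrite /disc_terms !big_cons big_nil !pos !neg /quartic_disc.
rewrite -![Pos.to_nat 256]/256%N -![Pos.to_nat 192]/192%N -![Pos.to_nat 128]/128%N
  -![Pos.to_nat 144]/144%N -![Pos.to_nat 27]/27%N -![Pos.to_nat 6]/6%N
  -![Pos.to_nat 80]/80%N -![Pos.to_nat 18]/18%N -![Pos.to_nat 16]/16%N
  -![Pos.to_nat 4]/4%N -![Pos.to_nat 1]/1%N.
ring.
Qed.

(** * The discriminant as a combination of falling monomials *)

Section Delta.
Variables (R : realType) (n : nat).
Let x := Z.of_nat n.

Lemma ZtoF_sub_nat i : ZtoF R (x - Z.of_nat i)%BZ = n%:R - i%:R.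
Proof. by rewrite ZtoFD ZtoFN !ZtoF_nat. Qed.

Lemma ZtoF_ffactZ m : ZtoF R (ffactZ x m) = (n ^_ m)%:R.
Proof.
have -> : ZtoF R (ffactZ x m) = \prod_(0 <= i < m) (n%:R - i%:R).
  rewrite /ffactZ /index_iota subn0; elim: (iota 0 m) => [|i s IH] /=; first by rewrite big_nil.
  by rewrite big_cons -IH ZtoFM ZtoF_sub_nat.
elim: m => [|m IH]; first by rewrite big_nil ffactn0.
rewrite big_nat_recr //= IH ffactnSr natrM.
have [mn|nm] := leqP m n; first by rewrite natrB.
by rewrite ffact_small // !mul0r.
Qed.

Lemma ev_weigh P : ev (@avg_mon R n) (weigh x P) = ev (@falling_mon R n) P.
Proof.
rewrite /ev big_map; apply: eq_bigr => t _.
by rewrite /= ZtoFM ZtoF_ffactZ /falling_mon [RHS]scalerA mulrC.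
Qed.

Lemma ev_sum_lcomb (V : lmodType R) (B : seq nat -> V) cs Ps :
  ev B (sum_lcomb cs Ps) = \sum_(cP <- zip cs Ps) ZtoF R cP.1 *: ev B cP.2.
Proof.
rewrite /sum_lcomb; elim: (zip cs Ps) => [|cP s IH] /=; first by rewrite /ev !big_nil.
by rewrite ev_add ev_scale IH big_cons.
Qed.

Lemma ev_elem_monomial c i0 i1 i2 i3 i4 :
  ev (@falling_mon R n) (elem_monomial (c, (i0, i1, i2, i3, i4))) =
  elem R n 1 ^+ i1 * (elem R n 2 ^+ i2 * (elem R n 3 ^+ i3 * elem R n 4 ^+ i4)).
Proof.
have ev_iter k i P : ev (@falling_mon R n) (iter i (mul_elem k) P) =
    elem R n k ^+ i * ev (@falling_mon R n) P.
  by elim: i => [|i IH] /=; rewrite ?mul1r // ev_mul_elem IH exprS mulrA.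
rewrite /elem_monomial !ev_iter; congr (_ * (_ * (_ * _))).
rewrite /ev big_seq1 scale1r /falling_mon ffactn0 scale1r /avg_mon.
rewrite (eq_bigr (fun _ => 1)); last first.
  by move=> s _; rewrite /perm_mon big1 // => i _; rewrite nth_nil.
rewrite sumr_const card_Sn -scaler_nat scalerA mulVf ?scale1r ?mulr1 //.
by rewrite pnatr_eq0 -lt0n fact_gt0.
Qed.

Lemma quartic_scalarZ : (4 <= n)%N ->
  [/\ quartic_scalar R n 0 = ZtoF R (x * (x - 1) * (x - 2) * (x - 3))%BZ,
      quartic_scalar R n 1 = ZtoF R ((-4) * ((x - 1) * (x - 2) * (x - 3)))%BZ,
      quartic_scalar R n 2 = ZtoF R (6 * ((x - 2) * (x - 3)))%BZ,
      quartic_scalar R n 3 = ZtoF R ((-4) * (x - 3))%BZ &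
      quartic_scalar R n 4 = 1].
Proof.
move=> n4.
have E k : (k <= 3)%N -> (n - k)%:R = ZtoF R (x - Z.of_nat k)%BZ.
  by move=> k3; rewrite ZtoF_sub_nat natrB // (leq_trans k3) // ltnW.
have E0 : n%:R = ZtoF R x by rewrite ZtoF_nat.
have [[E1 E2] E3] := (E 1%N isT, E 2%N isT, E 3%N isT).
rewrite /quartic_scalar !ZtoFM -[(x - 1)%BZ]/(x - Z.of_nat 1)%BZ
  -[(x - 2)%BZ]/(x - Z.of_nat 2)%BZ -[(x - 3)%BZ]/(x - Z.of_nat 3)%BZ -E0 -E1 -E2 -E3.
rewrite !ffactnS !ffactn0 -!subnS !subn0 !muln1 !natrM.
split.
- rewrite bin0; ring.
- have -> : ZtoF R (-4) = - 4%:R by [].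
  by rewrite bin1; ring.
- have -> : ZtoF R 6 = 6%:R by [].
  by rewrite (_ : 'C(4, 2) = 6%N) //; ring.
- have -> : ZtoF R (-4) = - 4%:R by [].
  by rewrite (_ : 'C(4, 3) = 4%N) //; ring.
by rewrite binn; ring.
Qed.

Lemma ZtoF_powZ z m : ZtoF R (powZ z m) = ZtoF R z ^+ m.
Proof. by elim: m => //= m IH; rewrite ZtoFM IH exprS. Qed.

Lemma ZtoF_disc_coef c i0 i1 i2 i3 i4 : (4 <= n)%N ->
  ZtoF R (disc_coef x (c, (i0, i1, i2, i3, i4))) = ZtoF R c * (quartic_scalar R n 0 ^+ i0 *
    (quartic_scalar R n 1 ^+ i1 * (quartic_scalar R n 2 ^+ i2 * quartic_scalar R n 3 ^+ i3))).
Proof.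
move=> n4; have [-> -> -> -> _] := quartic_scalarZ n4.
by rewrite /disc_coef 4!ZtoFM !ZtoF_powZ.
Qed.

Lemma Ddisc_ev : (4 <= n)%N ->
  (24%:R : R) ^+ 6 *: Ddisc R n (n - 4) = (n - 4)`!%:R ^+ 6 *:
    \sum_(t <- disc_terms) ZtoF R (disc_coef x t) *: ev (@falling_mon R n) (elem_monomial t).
Proof.
move=> n4; rewrite Ddisc_elem // quartic_disc_terms; congr (_ *: _).
have [_ _ _ _ ->] := quartic_scalarZ n4.
apply: eq_bigr => -[c [[[[i0 i1] i2] i3] i4]] _.
rewrite ev_elem_monomial ZtoF_disc_coef // /ZtoF {1}/elem /newton /= scale1r.
move: (quartic_scalar R n 0) (quartic_scalar R n 1) => s0 s1.
move: (quartic_scalar R n 2) (quartic_scalar R n 3) => s2 s3.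
rewrite -!mul_mpolyC !rmorphM !rmorphXn /= rmorph_int !exprMn expr1n; ring.
Qed.
End Delta.

(** * Separation of the discriminant from the cone *)

Section Nonmembership.
Variables (R : realType) (n : nat).
Hypothesis n12 : (12 <= n)%N.
Notation wf := (@weight_form R n).
Let n4 : (4 <= n)%N. Proof. exact: leq_trans n12. Qed.

Lemma weight_form_edge_sym g : all (edge_in n) g ->
  wf (edge_sym R n g) = n`!%:R * ZtoF R (edges_weight g).
Proof.
move=> gn; rewrite edge_symE // linearZ /=; congr (_ * _).
rewrite /ev linear_sum /edges_weight; have := size_expand gn.
elim: (expand g) => [|t P IH] /=; first by rewrite big_nil.
move=> /andP[tn Pn]; rewrite big_cons IH // ZtoFD ZtoFM; congr (_ + _).
by rewrite linearZ /= weight_form_avg_mon.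
Qed.

(** The levels start from the empty graph and use labels below 12 only, since six edges meet at most
    twelve vertices; one computation thus covers all n >= 12. *)
Lemma check_levels_6 : check_levels 6 [:: [::]].
Proof. by vm_compute. Qed.

Lemma weight_form_graph_ge0 (G : multigraph n) : square_graph G -> degree G = 12 ->
  0 <= wf (graph_sym R G).
Proof.
move=> /(square_graph_edges R)[g [gn dg ->]] d12.
have g6 : size g = 6 by lia.
have ge0 h : all (edge_in n) h -> (0 <= edges_weight h)%BZ -> 0 <= wf (edge_sym R n h).
  by move=> hn vh; rewrite weight_form_edge_sym // mulr_ge0 ?ler0n ?ZtoF_ge0.
(* All six edges of [g] count as still to be added to the empty graph. *)
rewrite -[g]cats0.
exact: (check_levels_sym (Q := fun p => 0 <= wf p) n12 ge0 check_levels_6 (mem_head _ _) gn g6).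
Qed.

Lemma weight_form_ev_falling_mon P :
  all (fun t => (size t.1 \in [:: 3; 4]%N) || (weight t.1 == 0%BZ)) P ->
  wf (ev (@falling_mon R n) P) =
  ZtoF R (ffactZ (Z.of_nat n) 3 * pairing 3 P + ffactZ (Z.of_nat n) 4 * pairing 4 P)%BZ.
Proof.
rewrite ZtoFD (ZtoFM _ (ffactZ _ 3)) (ZtoFM _ (ffactZ _ 4)) !ZtoF_ffactZ.
elim: P => [_|t P IH /= /andP[tP /IH{IH}IH]]; first by rewrite /ev big_nil linear0 !mulr0 addr0.
rewrite /ev big_cons -/(ev _ _) linearD linearZ /= IH.
have -> : wf (falling_mon R n t.1) = (n ^_ size t.1)%:R * ZtoF R (weight t.1).
  rewrite linearZ /=; have [tn|nt] := leqP (size t.1) n.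
    by rewrite weight_form_avg_mon.
  by rewrite ffact_small // !mul0r.
case/orP: tP => [|/eqP ->].
  by rewrite !inE => /orP[] /eqP -> /=; rewrite ZtoFD ZtoFM; ring.
by rewrite ZtoF0 Z.mul_0_r !Z.add_0_l !if_same; ring.
Qed.

(** Every term of the quartic discriminant contains a or b, so a monomial in at most two variables
    cannot reach degree 12 there; and [weights] has no partition with more than four parts. *)
Lemma elem_monomial_weights :
  all (fun t => all (fun u => (size u.1 \in [:: 3; 4]%N) || (weight u.1 == 0%BZ))
                    (elem_monomial t)) disc_terms.
Proof. by vm_compute. Qed.

Lemma weight_form_Ddisc : (23 <= n)%N -> wf (Ddisc R n (n - 4)) < 0.
Proof.
move=> n23.
have c0 : 0 < 24%:R ^+ 6 :> R by rewrite exprn_gt0.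
rewrite -(pmulr_rlt0 _ c0) -[_ * _]/(_ *: _) -linearZ /= Ddisc_ev // linearZ /=.
rewrite pmulr_rlt0 ?exprn_gt0 ?ltr0n ?fact_gt0 //.
have -> : wf (\sum_(t <- disc_terms)
      ZtoF R (disc_coef (Z.of_nat n) t) *: ev (@falling_mon R n) (elem_monomial t))
  = ZtoF R (disc_pairing (Z.of_nat n) term_pairings).
  rewrite linear_sum /term_pairings; have := elem_monomial_weights.
  elim: disc_terms => [|t s IH] /=; first by rewrite big_nil.
  move=> /andP[tw sw]; rewrite big_cons ZtoFD ZtoFM -IH //; congr (_ + _).
  by rewrite linearZ /= weight_form_ev_falling_mon.
have := @disc_pairing_lt0 (Z.of_nat n) _.
move: (disc_pairing _ _) => z lt_z0; rewrite -oppr_gt0 -ZtoFN; apply: ZtoF_gt0.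
by have := lt_z0 ltac:(lia); lia.
Qed.

Lemma Ddisc_notin_cone : (23 <= n)%N -> ~ square_cone 12 (Ddisc R n (n - 4)).
Proof.
move=> n23 [N [c [G [c0 Gsq E]]]].
have := weight_form_Ddisc n23; rewrite ltNge E linear_sum sumr_ge0 // => i _.
rewrite linearZ /= mulr_ge0 ?c0 //.
by have [sq d] := Gsq i; apply: weight_form_graph_ge0.
Qed.
End Nonmembership.

(** * Soundness of the certificates *)

Section Membership.
Variables (R : realType) (n : nat).

Lemma square_coneZ d (a : R) (p : {mpoly R[n]}) :
  0 <= a -> square_cone d p -> square_cone d (a *: p).
Proof.
move=> a0 [N [c [G [c0 Gsq ->]]]]; exists N, (fun i => a * c i), G; split=> //.
  by move=> i; rewrite mulr_ge0.
by rewrite scaler_sumr; apply: eq_bigr => i _; rewrite scalerA.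
Qed.

Lemma square_cone_sum d (us : seq (R * edges)) :
  all (fun u => (0 <= u.1) && all (proper_edge n) u.2 && (2 * size u.2 == d)%N) us ->
  square_cone d (\sum_(u <- us) u.1 *: edge_sym R n u.2).
Proof.
move=> /allP usP; pose u i := tnth (in_tuple us) i.
have uP i : [&& 0 <= (u i).1, all (proper_edge n) (u i).2 & (2 * size (u i).2 == d)%N].
  by rewrite andbA; apply: usP; apply: mem_tnth.
exists (size us), (fun i => (u i).1), (fun i => edge_graph n (u i).2); split=> [i|i|].
- by have /andP[] := uP i.
- have /and3P[_ un /eqP <-] := uP i; split; first exact: edge_graph_square.
  exact: degree_edge_graph.
rewrite big_tnth; apply: eq_bigr => i _; have /and3P[_ un _] := uP i.
by rewrite graph_sym_edge_graph.
Qed.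

Lemma check_rows_true : check_rows.
Proof. by vm_compute. Qed.

(** The vanishing test in the row gives k D = g S, with D a positive multiple of the discriminant
    and S a nonnegative combination of graphs; solving for the discriminant leaves a nonnegative
    factor. *)
Lemma check_row_cone DP GP k g cs :
  DP = [seq elem_monomial t | t <- disc_terms] ->
  GP = [seq collect (expand h) | h <- cert_graphs] ->
  (4 <= n)%N -> check_row DP GP (n, k, g, cs) -> square_cone 12 (Ddisc R n (n - 4)).
Proof.
move=> -> -> n4 /and4P[/Z.ltb_lt k0 /Z.leb_le g0 csn /eqP E].
set x := Z.of_nat n in E; set D := sum_lcomb _ _ in E; set S := sum_lcomb cs _ in E.
have {E} E : ZtoF R k *: ev (@falling_mon R n) D = ZtoF R g *: ev (@avg_mon R n) S.
  apply/eqP; rewrite -subr_eq0 -!ev_scale -ev_weigh -scaleN1r.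
  have <- : ev (@avg_mon R n) (scale_lcomb (Z.opp g) S)
      = -1 *: ev (@avg_mon R n) (scale_lcomb g S).
    by rewrite !ev_scale ZtoFN scalerA mulN1r.
  by rewrite -ev_add -ev_strip E /ev big_nil.
have evD : ev (@falling_mon R n) D = (24%:R / (n - 4)`!%:R) ^+ 6 *: Ddisc R n (n - 4).
  rewrite exprMn exprVn mulrC -scalerA Ddisc_ev // scalerA mulVf ?scale1r; last first.
    by rewrite expf_neq0 // pnatr_eq0 -lt0n fact_gt0.
  rewrite /D ev_sum_lcomb; elim: disc_terms => [|t s IH] /=; first by rewrite !big_nil.
  by rewrite !big_cons IH.
have kp : 0 < ZtoF R k by apply: ZtoF_gt0.
(* [a] collects g / k, the sixth power coming from [Ddisc_ev], and the 1 / n! of the averages. *)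
pose a : R := ZtoF R g / ZtoF R k * ((n - 4)`!%:R / 24%:R) ^+ 6 * n`!%:R^-1.
have a0 : 0 <= a by rewrite !mulr_ge0 ?exprn_ge0 ?divr_ge0 ?invr_ge0 ?ZtoF_ge0 ?ler0n //; lia.
(* Graphs with coefficient 0 are dropped, as they may have labels outside the vertex set. *)
pose us := [seq (ZtoF R u.1, u.2) | u <- zip cs cert_graphs & u.1 != 0%BZ].
suff -> : Ddisc R n (n - 4) = a *: \sum_(u <- us) u.1 *: edge_sym R n u.2.
  apply: square_coneZ => //; apply: square_cone_sum; apply/allP => u /mapP[[z h]].
  rewrite mem_filter /= => /andP[z0 zh] -> {u}.
  have := allP csn _ zh; rewrite /= (negPf z0) /= => /and3P[/Z.leb_le z_ge0 -> /eqP ->].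
  by rewrite ZtoF_ge0.
have evS : ev (@avg_mon R n) S = n`!%:R^-1 *: \sum_(u <- us) u.1 *: edge_sym R n u.2.
  rewrite /S ev_sum_lcomb big_map big_filter.
  have -> : zip cs [seq collect (expand h) | h <- cert_graphs] =
    [seq (u.1, collect (expand u.2)) | u <- zip cs cert_graphs].
    by elim: cs cert_graphs {csn E S us} => [|z cs IH] [|h hs] //=; rewrite IH.
  rewrite big_map scaler_sumr [LHS](bigID (fun u => u.1 == 0%BZ)) /= big1 ?add0r; last first.
    by move=> u /eqP ->; rewrite scale0r.
  rewrite big_seq_cond [RHS]big_seq_cond; apply: eq_bigr => -[z h] /andP[zh /= z0].
  have := allP csn _ zh; rewrite /= (negPf z0) /= => /and3P[_ hn _].
  have {}hn := proper_in hn.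
  rewrite ev_collect ?size_expand // edge_symE // !scalerA; congr (_ *: _).
  by rewrite mulrAC mulVf ?mul1r // pnatr_eq0 -lt0n fact_gt0.
move: E; rewrite evD evS.
move=> /(congr1 (fun p => ((ZtoF R k)^-1 * ((n - 4)`!%:R / 24%:R) ^+ 6) *: p)).
rewrite !scalerA => E; rewrite /a -[LHS]scale1r; move: E.
rewrite (_ : _ * _ * _ * _ = 1); first by move=> ->; congr (_ *: _); ring.
by field; rewrite !pnatr_eq0 -!lt0n fact_gt0 lt0r_neq0.
Qed.

Lemma Ddisc_cone : (4 <= n <= 22)%N -> square_cone 12 (Ddisc R n (n - 4)).
Proof.
move=> /andP[n4 n22].
have : n \in [seq r.1.1.1 | r <- cert_rows].
  by rewrite [map _ _](_ : _ = iota 4 19) // mem_iota n4 ltnS.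
case/mapP => -[[[m k] g] cs] r_in /= mE; have := allP check_rows_true _ r_in; rewrite -mE.
exact: check_row_cone.
Qed.
End Membership.

Theorem theorem9 (R : realType) :
  (forall n : nat, (4 <= n)%N ->
     (square_cone 12 (Delta4 R n) <-> (4 <= n <= 22)%N))
  /\ ~ (forall n k : nat, (2 <= n)%N -> (k <= n - 2)%N ->
          square_cone ((n - k) * (n - k - 1))%N (Ddisc R n k))
  /\ (forall n : nat, (23 <= n)%N -> ~ square_cone 12 (Ddisc R n (n - 4)))
  /\ (forall n : nat, (4 <= n <= 22)%N -> square_cone 12 (Ddisc R n (n - 4)))
  /\ ~ square_cone 12 (Ddisc R 23 19).
Proof.
have notin n : (23 <= n)%N -> ~ square_cone 12 (Ddisc R n (n - 4)).
  by move=> n23; apply: Ddisc_notin_cone => //; apply: leq_trans n23.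
have notin23 : ~ square_cone 12 (Ddisc R 23 19) := notin 23%N isT.
split; last split; last split; last split => //.
(* [Delta4] is a positive multiple of [Ddisc], and the cone is closed under scaling by the factor
   and by its inverse. *)
- move=> n n4; have c_gt0 : 0 < (24%:R / n`!%:R : R) ^+ 6.
    by rewrite exprn_gt0 // divr_gt0 ?ltr0n ?fact_gt0.
  split=> [|n22]; last by apply: square_coneZ; [exact: ltW | exact: Ddisc_cone].
  move=> inD; rewrite n4 leqNgt; apply/negP => n23; apply: (notin n n23).
  rewrite -[Ddisc _ _ _]scale1r -(mulVf (lt0r_neq0 c_gt0)) -scalerA.
  by apply: square_coneZ => //; rewrite invr_ge0 ltW.
(* For n = 23 and k = 19 the degree (n-k)(n-k-1) is 4 * 3 = 12. *)
- by move=> all_in; apply: notin23; apply: (all_in 23%N 19%N).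
- exact: notin.
by move=> n; apply: Ddisc_cone.
Qed.
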